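(* Let $N=4$, let $\gamma\in(-1,1)\setminus\{0\}$, and let the circulations be $\Gamma_1=\Gamma_2=1$, $\Gamma_3=\Gamma_4=\gamma$. Let $\mu_0\in\mathfrak v_{\mathcal K}$ be the fixed point of the Lie–Poisson relative dynamics $\dot\mu=X_h(\mu)$ corresponding to the Rhombus-A relative equilibrium. Then: (a) if $-2+\sqrt3<\gamma<0$ or $0<\gamma<1$, then $\mu_0$ is Lyapunov stable to $F^{-1}(0)$-preserving perturbations; (b) if $-1<\gamma<-2+\sqrt3$, then $\mu_0$ is linearly unstable.
   Context: **Rhombus-A equilibrium.** Set $$\alpha=\tfrac12\Bigl(3(1-\gamma)+\sqrt{9(1-\gamma)^2+4\gamma}\Bigr).$$ Vortices $1,2$ (circulation $1$) and $3,4$ (circulation $\gamma$) are located at opposite vertices of a rhombus with diagonals satisfying $(r_{34}/r_{12})^2=\alpha$, where $r_{ij}=|q_i-q_j|$. Normalized so that $r_{12}=2$, the positions in $\mathbb{C}$ are $q_1=1$, $q_2=-1$, $q_3=\mathrm{i}\sqrt\alpha$, $q_4=-\mathrm{i}\sqrt\alpha$. With $z=(q_1-q_4,\,q_2-q_4,\,q_3-q_4)^T\in\mathbb{C}^3$, the corresponding fixed point is $\mu_0=\mathrm{i}\,zz^*$. In the notation below its entries are $$\mu_1=\mu_2=\alpha+1,\quad \mu_3=4\alpha,\quad \mu_{12}=\alpha-1-2\mathrm{i}\sqrt\alpha,\quad \mu_{13}=2\alpha-2\mathrm{i}\sqrt\alpha,\quad \mu_{23}=2\alpha+2\mathrm{i}\sqrt\alpha.$$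 **Vector space.** $\mathfrak v_{\mathcal K}=\{\mu\in\mathbb{C}^{3\times3}\mid\mu^*=-\mu\}\cong\mathbb{R}^9$ with inner product $\langle\xi,\eta\rangle=\frac12\operatorname{tr}(\xi^*\eta)$. Each $\mu$ is written $\mu=\mathrm{i}A$ with $A$ Hermitian having diagonal entries $\mu_1,\mu_2,\mu_3\in\mathbb{R}$ and upper off-diagonal entries $\mu_{12},\mu_{13},\mu_{23}\in\mathbb{C}$. **Dynamics.** Let $\Gamma=\sum_{i=1}^4\Gamma_i=2(1+\gamma)\neq0$. Let $\mathcal K$ be the (invertible) real symmetric $3\times3$ matrix with $\mathcal K_{ii}=-\Gamma_i(\Gamma-\Gamma_i)/\Gamma$ and $\mathcal K_{ij}=\Gamma_i\Gamma_j/\Gamma$ for $i\neq j$. Let $$h(\mu)=-\frac1{4\pi}\Bigl(\Gamma_4\sum_{i=1}^{3}\Gamma_i\ln\mu_i+\sum_{1\le i<j\le 3}\Gamma_i\Gamma_j\ln(\mu_i+\mu_j-2\operatorname{Re}\mu_{ij})\Bigr)$$ on the open set where the arguments of the logarithms are positive. Define $\delta h/\delta\mu\in\mathfrak v_{\mathcal K}$ by $\langle\nu,\delta h/\delta\mu\rangle=\frac{d}{ds}\big|_{s=0}h(\mu+s\nu)$ for all $\nu$. The dynamics is $$\dot\mu=X_h(\mu)=-\mu\,\frac{\delta h}{\delta\mu}\,\mathcal K^{-1}+\mathcal K^{-1}\,\frac{\delta h}{\delta\mu}\,\mu.$$ **Constraint set.** On the open set $\mathring{\mathfrak v}_{\mathcal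 K}$ of $\mu\in\mathfrak v_{\mathcal K}$ with all $\mu_i\neq0$ and all $\mu_{ij}\ne0$, let $F=(F_1,F_2,F_{12})$ with $F_1=\mu_1\mu_2-|\mu_{12}|^2$, $F_2=\mu_2\mu_3-|\mu_{23}|^2$, $F_{12}=\mu_{12}\mu_{23}-\mu_{13}\mu_2$. Then $F^{-1}(0)$ is the set of rank-one elements of $\mathring{\mathfrak v}_{\mathcal K}$ and is invariant under the dynamics. **Stability notions.** $\mu_0$ is Lyapunov stable to $F^{-1}(0)$-preserving perturbations if for every neighborhood $U$ of $\mu_0$ in $F^{-1}(0)$ there is a neighborhood $V\subset U$ of $\mu_0$ in $F^{-1}(0)$ such that every solution with $\mu(0)\in V$ satisfies $\mu(t)\in U$ for all $t\ge0$. $\mu_0$ is linearly unstable if the linearization $DX_h(\mu_0)$ on $\mathbb{R}^9$ has an eigenvalue with positive real part. *)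

(* Defs.v *)
From HB Require Import structures.
From mathcomp Require Import all_boot all_order all_algebra.
From mathcomp Require Import all_classical all_reals all_analysis.
From mathcomp Require Export complex.
From mathcomp Require Import ring.

Set Implicit Arguments.
Unset Strict Implicit.
Unset Printing Implicit Defensive.

Import Order.TTheory GRing.Theory Num.Theory.
Import numFieldNormedType.Exports.

Local Open Scope classical_set_scope.
Local Open Scope sesquilinear_scope.
Local Open Scope ring_scope.
Local Open Scope complex_scope.

(** Indices are shifted by one: vortices 1..4 are 0..3 in ['I_4], and rows and
    columns 1..3 are 0..2 in ['I_3]. *)

Section Space.
Variable R : realType.

Definition skewhermitian : set 'M[R[i]]_3 := [set m | m ^t* = - m].

(** [skewhermitian] is handled through the real coordinates
    (mu_1, mu_2, mu_3, Re mu_12, Im mu_12, Re mu_13, Im mu_13, Re mu_23, Im mu_23),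
    which give it the topology and the differential structure of R^9.
    [herm x] is the Hermitian matrix A of the decomposition mu = i A, and
    [vK x] is mu itself. *)
Definition herm (x : 'rV[R]_9) : 'M[R[i]]_3 :=
  let re k := (x 0 (inord k))%:C in
  let cx k l := x 0 (inord k) +i* x 0 (inord l) in
  \matrix_(i, j) nth 0 (nth [::]
    [:: [:: re 0%N;          cx 3%N 4%N;        cx 5%N 6%N];
        [:: (cx 3%N 4%N)^*;  re 1%N;            cx 7%N 8%N];
        [:: (cx 5%N 6%N)^*;  (cx 7%N 8%N)^*;    re 2%N]] i) j.

Definition vK (x : 'rV[R]_9) : 'M[R[i]]_3 := 'i *: herm x.

Definition vKcoord (m : 'M[R[i]]_3) : 'rV[R]_9 :=
  let A := - 'i *: m in
  \row_k nth 0 [:: complex.Re (A 0 0); complex.Re (A 1 1); complex.Re (A 2 2);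
                   complex.Re (A 0 1); complex.Im (A 0 1);
                   complex.Re (A 0 2); complex.Im (A 0 2);
                   complex.Re (A 1 2); complex.Im (A 1 2)] k.

Definition mud (x : 'rV[R]_9) (i : 'I_3) : R := complex.Re (herm x i i).
Definition muo (x : 'rV[R]_9) (i j : 'I_3) : R[i] := herm x i j.

Definition innerK (xi eta : 'M[R[i]]_3) : R :=
  complex.Re (2^-1 * \tr ((xi ^t*) *m eta)).

End Space.

Section Dynamics.
Variables (R : realType) (Gam : 'I_4 -> R).

Definition totcirc : R := \sum_i Gam i.

Definition circ3 (i : 'I_3) : R := Gam (widen_ord (leqnSn 3) i).

Definition Kmx : 'M[R]_3 := \matrix_(i, j)
  if i == j then - circ3 i * (totcirc - circ3 i) / totcirc
  else circ3 i * circ3 j / totcirc.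

Definition sqdist (x : 'rV[R]_9) (i j : 'I_3) : R :=
  mud x i + mud x j - 2 * complex.Re (muo x i j).

Definition hdomain : set 'rV[R]_9 :=
  [set x | (forall i, 0 < mud x i) /\
           (forall i j : 'I_3, (i < j)%N -> 0 < sqdist x i j)].

Definition ham (x : 'rV[R]_9) : R :=
  - (4 * pi)^-1 *
    (Gam ord_max * (\sum_i circ3 i * ln (mud x i)) +
     \sum_(i < 3) \sum_(j < 3 | (i < j)%N) circ3 i * circ3 j * ln (sqdist x i j)).

Definition is_fderiv (x D : 'rV[R]_9) : Prop :=
  forall nu : 'rV[R]_9,
    is_derive (0 : R) 1 (fun s : R => ham (x + s *: nu))
      (innerK (vK nu) (vK D)).

(** The derivative is unique when it exists ([innerK] is an inner product), and
    it exists on [hdomain]; outside of [hdomain] the value is irrelevant. *)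
Definition fderiv (x : 'rV[R]_9) : 'rV[R]_9 := get (is_fderiv x).

Definition Xmx (x : 'rV[R]_9) : 'M[R[i]]_3 :=
  let Kinv := map_mx (real_complex R) (invmx Kmx) in
  - (vK x *m vK (fderiv x) *m Kinv) + Kinv *m vK (fderiv x) *m vK x.

Definition Xh (x : 'rV[R]_9) : 'rV[R]_9 := vKcoord (Xmx x).

End Dynamics.

Section Constraint.
Variable R : realType.

Definition vKring : set 'rV[R]_9 :=
  [set x | (forall i, mud x i != 0) /\
           (forall i j : 'I_3, (i < j)%N -> muo x i j != 0)].

Definition Fmap (x : 'rV[R]_9) : R * R * R[i] :=
  (mud x 0 * mud x 1 - (Normc.normc (muo x 0 1)) ^+ 2,
   mud x 1 * mud x 2 - (Normc.normc (muo x 1 2)) ^+ 2,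
   muo x 0 1 * muo x 1 2 - muo x 0 2 * (mud x 1)%:C).

Definition F0 : set 'rV[R]_9 := vKring `&` [set x | Fmap x = (0, 0, 0)].

End Constraint.

Section Stability.
Variables (R : realType) (n : nat).
Variables (D : set 'rV[R]_n) (X : 'rV[R]_n -> 'rV[R]_n).

(** Solutions of x' = X x on [0, T) that stay in the domain [D] of [X].  At 0,
    continuity replaces a one-sided derivative. *)
Definition is_solution (T : R) (u : R -> 'rV[R]_n) : Prop :=
  [/\ forall t, 0 <= t < T -> D (u t),
      {within `[0, T[%classic, continuous u} &
      forall t : R, 0 < t < T -> is_derive t 1 u (X (u t))].

(** [within S (nbhs p)] is the filter of neighborhoods of [p] relative to [S].
    All solutions are considered, whatever their interval of existence. *)
Definition lyapunov_stable_in (S : set 'rV[R]_n) (p : 'rV[R]_n) : Prop :=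
  forall U : set 'rV[R]_n, U `<=` S -> within S (nbhs p) U ->
  exists V : set 'rV[R]_n, [/\ V `<=` U, within S (nbhs p) V &
    forall (T : R) (u : R -> 'rV[R]_n), is_solution T u -> 0 < T -> V (u 0) ->
      forall t, 0 <= t < T -> U (u t)].

Definition linearly_unstable (p : 'rV[R]_n) : Prop :=
  differentiable X p /\
  exists2 lam : R[i], 0 < complex.Re lam &
    eigenvalue (map_mx (real_complex R) (jacobian X p)) lam.

End Stability.

Section Rhombus.
Variables (R : realType) (g : R).

Definition rhombus_circ (i : 'I_4) : R := if (i < 2)%N then 1 else g.

Definition alphaA : R :=
  2^-1 * (3 * (1 - g) + Num.sqrt (9 * (1 - g) ^+ 2 + 4 * g)).

Definition rhombusA (i : 'I_4) : R[i] :=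
  nth 0 [:: 1; -1; 0 +i* Num.sqrt alphaA; 0 -i* Num.sqrt alphaA] i.

Definition zA : 'cV[R[i]]_3 :=
  \col_i (rhombusA (widen_ord (leqnSn 3) i) - rhombusA ord_max).

Definition mu0 : 'rV[R]_9 := vKcoord ('i *: (zA *m zA ^t*)).

End Rhombus.

Section Coordinates.
Variable R : realType.

Lemma herm_adj (x : 'rV[R]_9) : (herm x) ^t* = herm x.
Proof.
apply/matrixP => i j; rewrite !mxE.
case: i => [[|[|[|//]]] ?]; case: j => [[|[|[|//]]] ?] //=;
  rewrite ?(conjc_real, conjcK) //; by apply/eqP; rewrite eq_complex /= ?oppr0 ?opprK !eqxx.
Qed.

Lemma vK_skewhermitian (x : 'rV[R]_9) : skewhermitian (vK x).
Proof.
rewrite /skewhermitian /= /vK linearZ map_mxZ /= herm_adj -scaleNr; congr (_ *: _).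
by apply/eqP; rewrite eq_complex /= oppr0 !eqxx.
Qed.

Let iiN : - 'i * 'i = 1 :> R[i].
Proof. by apply/eqP; rewrite eq_complex /=; apply/andP; split; apply/eqP; ring. Qed.

Lemma vKK : cancel (@vK R) (@vKcoord R).
Proof.
move=> x; rewrite /vKcoord /vK scalerA iiN scale1r; apply/rowP => k.
rewrite !mxE; case: k => [[|[|[|[|[|[|[|[|[|//]]]]]]]]] ?] /=;
  by congr (x _ _); apply/val_inj; rewrite /= inordK.
Qed.

Lemma vKcoordK (m : 'M[R[i]]_3) : skewhermitian m -> vK (vKcoord m) = m.
Proof.
rewrite /skewhermitian /= => hm; rewrite /vKcoord /vK.
have hA : (- 'i *: m) ^t* = - 'i *: m.
  rewrite linearZ map_mxZ /= hm scalerN -scaleNr; congr (_ *: _).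
  by apply/eqP; rewrite eq_complex /= ?opprK ?oppr0 ?opprK !eqxx.
rewrite -[RHS]scale1r -iiN mulrC -scalerA.
move: hA; move: (- 'i *: m) => A hA; congr (_ *: _).
have h i j : A i j = (A j i)^*.
  by have /matrixP/(_ i j) := hA; rewrite !mxE.
have e (z : R[i]) : complex.Re z +i* complex.Im z = z by case: z.
have e' i j : complex.Re (A i j) -i* complex.Im (A i j) = A j i.
  by rewrite (h j i); case: (A i j).
have d i : (complex.Re (A i i))%:C = A i i.
  have := h i i; case: (A i i) => a b /= [] /esym/eqP.
  by rewrite -subr_eq0 -opprD oppr_eq0 -mulr2n mulrn_eq0 /= => /eqP ->.
apply/matrixP => i j; rewrite !mxE !inordK //=.
case: i => [[|[|[|//]]] hi]; case: j => [[|[|[|//]]] hj] /=; rewrite ?e ?e' ?d;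
  by congr (fun_of_matrix A _ _); apply/val_inj.
Qed.

Lemma Xmx_skewhermitian (Gam : 'I_4 -> R) (x : 'rV[R]_9) :
  skewhermitian (Xmx Gam x).
Proof.
rewrite /skewhermitian /= /Xmx.
set K := map_mx (real_complex R) _; set D := vK (fderiv _ _).
have hK : K ^t* = K.
  have : (invmx (Kmx Gam))^T = invmx (Kmx Gam).
    rewrite trmx_inv; congr invmx; apply/matrixP => i j; rewrite !mxE eq_sym.
    by case: eqP => [->|_] //; rewrite [circ3 _ j * _]mulrC.
  rewrite /K; move: (invmx _) => B hB; apply/matrixP => i j; rewrite !mxE /=.
  by move/matrixP/(_ i j): hB; rewrite mxE => ->; exact: conjc_real.
rewrite linearD linearN /= map_mxD map_mxN !trmx_mul !map_mxM /= hK.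
by rewrite !vK_skewhermitian !mulmxN !mulNmx !mulmxN !opprK !mulmxA opprD opprK addrC.
Qed.

End Coordinates.

Lemma vK_mu0 (R : realType) (g : R) : vK (mu0 g) = 'i *: (zA g *m zA g ^t*).
Proof.
apply: vKcoordK; rewrite /skewhermitian /= linearZ map_mxZ /=.
rewrite trmx_mul map_mxM /= trmxCK -scaleNr; congr (_ *: _).
by apply/eqP; rewrite eq_complex /= oppr0 !eqxx.
Qed.

(* Main.v *)
Require Import Defs.
From mathcomp Require Import all_boot all_order all_algebra.
From mathcomp Require Import all_classical all_reals all_analysis.
From mathcomp Require Import ring lra.

(** Write [a = q1 - q2], [b = q3 - q4] and [c = (q1 + q2 - q3 - q4) / 2]; in these
    Jacobi vectors the circulation matrix is diagonal and, for [mu = i A] of rank one,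
    all squared distances are functions of [|a|^2], [|b|^2], [a b^*] and [a c^*].

    Stability.  With [M = K^-1 (dh/dmu)] (a real matrix) the dynamics reads
    [A' = i (M A - A M^T)], so the adjugate satisfies [adj(A)' = i (M^T adj(A) - adj(A) M)];
    by Gronwall's inequality it stays zero, i.e. rank one is preserved.  The energy
    [E = - 4 pi h] and the impulse [C] (a linear Casimir) are conserved.  On rank-one
    elements with [C] fixed, [(lam C - E) / g] has a strict local minimum at [mu0]
    exactly when [g^2 + 4 g + 1 > 0]: its second variation is a sum of squares in
    [Re (a b^* )], [Re (a c^* )], [Im (a c^* )] and of one further form in
    [(|a|^2, |b|^2)], positive on the kernel of [dC].  A penalty [kap (C - C0)^2]
    turns it into a Lyapunov function.

    Instability.  When [g^2 + 4 g + 1 < 0] the form in [(|a|^2, |b|^2)] changes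
    sign and the linearization restricted to [c = 0] has a positive real eigenvalue. *)

Set Implicit Arguments.
Unset Strict Implicit.
Unset Printing Implicit Defensive.

Import Order.TTheory GRing.Theory Num.Theory.
Import numFieldNormedType.Exports.

Local Open Scope classical_set_scope.
Local Open Scope ring_scope.

(** * Coordinates *)

(** In the code [b] is sqrt alpha and [a] its square, not the Jacobi vectors. The quadratic equation
    of alpha is linear in the circulation, so [g = a (3 - a) / (3 a - 1)] and all data at the
    equilibrium are rational in [b]; the identities of both halves are then rational identities in
    one parameter.

    Rank one matters because the expansion of [(lam C - E) / g] keeps a term linear in [|c|^2], of
    no definite sign. On rank-one elements [|a|^2 |c|^2 = |a c^*|^2] makes it of second order, so it
    can be weighed against the squares.

    The obstacle to stability is a circularity: the Lyapunov estimate needs rank one, while Gronwall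
    needs a bound on [M], known only near the equilibrium. Both are run up to the first time at
    which the solution reaches the boundary of a small ball. Up to then [M] is bounded, hence rank
    one still holds at that time, and there the conserved value of the Lyapunov function is too
    small. The whole adjugate is used rather than the components of [F] because its nine real
    coordinates obey a closed linear system. The nonvanishing conditions in the constraint set are
    recovered from closeness to [mu0]. *)

Notation "x .[: k ]" := (x ord0 (inord k)) (at level 2, format "x .[: k ]").

(* [ring] compares atoms up to conversion, which is very slow on [inord k]. *)
Ltac gen9 x :=
  let x0 := fresh x in let x1 := fresh x in let x2 := fresh x in
  let x3 := fresh x in let x4 := fresh x in let x5 := fresh x in
  let x6 := fresh x in let x7 := fresh x in let x8 := fresh x in
  move: (x.[: 0]) (x.[: 1]) (x.[: 2]) (x.[: 3]) (x.[: 4]) (x.[: 5])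
        (x.[: 6]) (x.[: 7]) (x.[: 8]) => x0 x1 x2 x3 x4 x5 x6 x7 x8.

Lemma row9E (R : pzRingType) (s : seq R) k : (k < 9)%N ->
  (\row_(i < 9) nth 0 s i).[: k] = nth 0 s k.
Proof. by move=> k9; rewrite mxE inordK. Qed.

Lemma row9P (R : pzRingType) (x y : 'rV[R]_9) :
  (forall k, (k < 9)%N -> x.[: k] = y.[: k]) -> x = y.
Proof. by move=> h; apply/rowP => k; rewrite -(inord_val k) h. Qed.

Lemma mulmx3E (R : pzRingType) (A B : 'M[R]_3) i j :
  (A *m B) i j = A i 0 * B 0 j + A i 1 * B 1 j + A i 2 * B 2 j.
Proof.
rewrite mxE !big_ord_recl big_ord0 addr0 addrA.
by congr (_ + A _ _ * B _ _ + A _ _ * B _ _); apply/val_inj.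
Qed.

Lemma sum3E (V : nmodType) (f : 'I_3 -> V) : \sum_i f i = f 0 + f 1 + f 2.
Proof.
rewrite !big_ord_recl big_ord0 addr0 addrA.
by congr (_ + f _ + f _); apply/val_inj.
Qed.

Section Coords.
Variable R : realType.
Implicit Types x nu : 'rV[R]_9.

Lemma mudE x i : mud x i = x.[: i].
Proof.
by rewrite /mud mxE; case: i => [[|[|[|//]]] ?] /=.
Qed.

Lemma mud3E x :
  ((mud x 0 = x.[: 0]) * (mud x 1 = x.[: 1]) * (mud x 2 = x.[: 2]))%type.
Proof. by rewrite !mudE. Qed.

Lemma sqdist01 x : sqdist x 0 1 = x.[: 0] + x.[: 1] - 2 * x.[: 3].
Proof. by rewrite /sqdist !mudE /muo mxE. Qed.
Lemma sqdist02 x : sqdist x 0 2 = x.[: 0] + x.[: 2] - 2 * x.[: 5].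
Proof. by rewrite /sqdist !mudE /muo mxE. Qed.
Lemma sqdist12 x : sqdist x 1 2 = x.[: 1] + x.[: 2] - 2 * x.[: 7].
Proof. by rewrite /sqdist !mudE /muo mxE. Qed.

Lemma vKE x :
  ((vK x 0 0 = (0 +i* x.[: 0])%C) * (vK x 1 1 = (0 +i* x.[: 1])%C) *
   (vK x 2 2 = (0 +i* x.[: 2])%C) *
   (vK x 0 1 = (- x.[: 4] +i* x.[: 3])%C) * (vK x 1 0 = (x.[: 4] +i* x.[: 3])%C) *
   (vK x 0 2 = (- x.[: 6] +i* x.[: 5])%C) * (vK x 2 0 = (x.[: 6] +i* x.[: 5])%C) *
   (vK x 1 2 = (- x.[: 8] +i* x.[: 7])%C) * (vK x 2 1 = (x.[: 8] +i* x.[: 7])%C))%type.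
Proof.
by do !split; rewrite /vK mxE [herm _ _ _]mxE /=; apply/eqP; rewrite eq_complex /=;
  apply/andP; split; apply/eqP; ring.
Qed.

Lemma vKcoordE (m : 'M[R[i]]_3) k : (k < 9)%N -> (vKcoord m).[: k] =
  nth 0 [:: complex.Im (m 0 0); complex.Im (m 1 1); complex.Im (m 2 2);
            complex.Im (m 0 1); - complex.Re (m 0 1); complex.Im (m 0 2);
            - complex.Re (m 0 2); complex.Im (m 1 2); - complex.Re (m 1 2)] k.
Proof.
move=> k9; rewrite /vKcoord row9E // !mxE.
have E (z : R[i]) : - 'i%C * z = (complex.Im z +i* (- complex.Re z))%C.
  by case: z => a b; apply/eqP; rewrite eq_complex /=; apply/andP; split; apply/eqP; ring.
by rewrite !E.
Qed.

Lemma innerK_vK x y : innerK (vK x) (vK y) =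
  (x.[: 0] * y.[: 0] + x.[: 1] * y.[: 1] + x.[: 2] * y.[: 2]) / 2
  + x.[: 3] * y.[: 3] + x.[: 4] * y.[: 4] + x.[: 5] * y.[: 5]
  + x.[: 6] * y.[: 6] + x.[: 7] * y.[: 7] + x.[: 8] * y.[: 8].
Proof.
have -> : innerK (vK x) (vK y) =
   2^-1 * complex.Re (\tr (((vK x) ^t* )%sesqui *m vK y)).
  rewrite /innerK.
  have -> : (2^-1 : R[i]) = (2^-1 : R)%:C%C by rewrite fmorphV /= rmorph_nat.
  by case: (\tr _) => a b /=; rewrite mul0r subr0.
have E i j : ((vK x) ^t* )%sesqui i j = ((vK x j i)^*)%C by rewrite !mxE.
rewrite /mxtrace sum3E !mulmx3E !E.
move: (vK x) (vK y) (vKE x) (vKE y) => A B hA hB; rewrite !hA !hB /=.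
by gen9 x; gen9 y; field.
Qed.

End Coords.

(** * Rules of differentiation for scalar functions, and locality of the differential *)

Section DeriveRules.
Variables (R : realType) (V : normedModType R).
Implicit Types (f h : V -> R) (x v : V).

Lemma is_derive_fcst (a : R) x v : is_derive x v (fun=> a) 0.
Proof. exact: is_derive_cst. Qed.

Lemma is_derive_fadd f h x v df dh : is_derive x v f df -> is_derive x v h dh ->
  is_derive x v (fun y => f y + h y) (df + dh).
Proof. exact: is_deriveD. Qed.

Lemma is_derive_fopp f x v df : is_derive x v f df ->
  is_derive x v (fun y => - f y) (- df).
Proof. exact: is_deriveN. Qed.

Lemma is_derive_fmul f h x v df dh : is_derive x v f df -> is_derive x v h dh ->
  is_derive x v (fun y => f y * h y) (f x * dh + h x * df).
Proof. exact: is_deriveM. Qed.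

Lemma is_derive_fsqr f x v df : is_derive x v f df ->
  is_derive x v (fun y => f y ^+ 2) (2 * f x * df).
Proof. by move=> d; apply: is_derive_eq (is_derive_fmul d d) _; ring. Qed.

End DeriveRules.

Lemma is_derive_fln (R : realType) (f : R -> R) (x df : R) : 0 < f x ->
  is_derive x 1 f df -> is_derive x 1 (fun y => ln (f y)) (df / f x).
Proof.
by move=> fx d; rewrite mulrC; apply: (is_derive1_comp (f := @ln R)) (is_derive1_ln fx) d.
Qed.

(** Both functions have the same first-order expansion at [x], and the differential is determined by
    the expansion. It serves to pass from [Xh], which is defined by a choice and known explicitly
    only on [hdomain], to a formula in coordinates. *)
Lemma near_eq_differentiable (R : realType) (V W : normedModType R)
    (f h : V -> W) (x : V) :
  (\near x, f x = h x) -> differentiable h x -> differentiable f x.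
Proof.
move=> fh dh.
have fhx : f x = h x by exact: nbhs_singleton fh.
have H : f \o shift x = cst (f x) + 'd h x +o_ 0 id.
  apply/eqaddoP => e e0.
  have /eqaddoP/(_ e e0) H := diff_locally dh.
  have c : (fun y : V => y + x) @ nbhs (0 : V) --> x.
    by rewrite -{2}[x]add0r; apply: cvgD; [exact: cvg_id|exact: cvg_cst].
  have G : \forall y \near (0 : V), f (y + x) = h (y + x) by exact: c _ fh.
  by apply: filterS2 G H => y; rewrite /= !fctE /= fhx => ->.
have E : 'd f x = 'd h x :> (V -> W) by apply: diff_unique H; exact: diff_continuous.
by apply/diff_locallyP; rewrite E; split=> //; exact: diff_continuous.
Qed.

Lemma differentiable_row (R : realType) (V : normedModType R) n
    (f : 'I_n -> V -> R) (x : V) :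
  (forall k, differentiable (f k) x) ->
  differentiable (fun y => \row_k f k y : 'rV[R]_n) x.
Proof.
move=> df.
have -> : (fun y => \row_k f k y : 'rV[R]_n) =
    \sum_(k < n) (fun y => f k y *: (delta_mx 0 k : 'rV[R]_n)).
  apply/funext => y; rewrite fct_sumE; apply/rowP => j; rewrite mxE summxE.
  rewrite (bigD1 j) //= !mxE !eqxx mulr1 big1 ?addr0 // => i ij.
  by rewrite !mxE eq_sym (negbTE ij) andbF mulr0.
by apply: differentiable_sum => k; exact: differentiableZl.
Qed.

(** * The vector field in coordinates *)

Section Equations.
Variables (R : realType) (g : R).
Implicit Types x nu : 'rV[R]_9.
Let Gam := rhombus_circ g.

(* [- 2 pi dh/dmu]; [r_i] and [r_ij] stand for [1 / mu_i] and [1 / |q_i - q_j|^2]. *)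
Definition lap6 (r1 r2 r3 r12 r13 r23 : R) : seq R :=
  [:: g * r1 + r12 + g * r13; g * r2 + r12 + g * r23; g ^+ 2 * r3 + g * r13 + g * r23;
      - r12; 0; - (g * r13); 0; - (g * r23); 0].

(** The six inverse squared distances are passed as arguments, so that they can be generalized to
    independent variables and the identities involving them become polynomial. *)
Definition invd (x : 'rV[R]_9) (F : R -> R -> R -> R -> R -> R -> seq R) : seq R :=
  F x.[: 0]^-1 x.[: 1]^-1 x.[: 2]^-1 (x.[: 0] + x.[: 1] - 2 * x.[: 3])^-1
    (x.[: 0] + x.[: 2] - 2 * x.[: 5])^-1 (x.[: 1] + x.[: 2] - 2 * x.[: 7])^-1.

(** The factor 1/2 in the inner product doubles the diagonal partial derivatives, and each
    [Re mu_ij] enters the Hamiltonian with a factor 2: this is why 1/(4 pi) becomes 1/(2 pi) in all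
    entries. *)
Definition dham (x : 'rV[R]_9) : 'rV[R]_9 :=
  \row_k (- (2 * pi)^-1 * nth 0 (invd x lap6) k).

Lemma hdomainE x : hdomain x <->
  [/\ 0 < x.[: 0], 0 < x.[: 1] & 0 < x.[: 2]] /\
  [/\ 0 < x.[: 0] + x.[: 1] - 2 * x.[: 3], 0 < x.[: 0] + x.[: 2] - 2 * x.[: 5] &
     0 < x.[: 1] + x.[: 2] - 2 * x.[: 7]].
Proof.
split=> [[h1 h2]|[[? ? ?] [? ? ?]]].
  split; first by have := (h1 0, h1 1, h1 2); rewrite !mudE => -[[]].
  by rewrite -sqdist01 -sqdist02 -sqdist12; split; apply: h2.
split; first by case=> [[|[|[|//]]] ?]; rewrite mudE.
by case=> [[|[|[|//]]] ?] [[|[|[|//]]] ?] //= _;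
  rewrite /sqdist !mudE /muo mxE.
Qed.

Lemma hamE x : ham Gam x = - (4 * pi)^-1 *
  (g * (ln x.[: 0] + ln x.[: 1] + g * ln x.[: 2])
   + (ln (x.[: 0] + x.[: 1] - 2 * x.[: 3])
      + g * ln (x.[: 0] + x.[: 2] - 2 * x.[: 5])
      + g * ln (x.[: 1] + x.[: 2] - 2 * x.[: 7]))).
Proof.
rewrite /ham; congr (_ * _).
have -> : \sum_(i < 3) \sum_(j < 3 | (i < j)%N)
    circ3 Gam i * circ3 Gam j * ln (sqdist x i j)
  = ln (sqdist x 0 1) + g * ln (sqdist x 0 2) + g * ln (sqdist x 1 2).
  under eq_bigr do rewrite big_mkcond sum3E.
  by rewrite sum3E /= /circ3 /Gam /rhombus_circ /= !mul1r !addr0 !add0r.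
rewrite sum3E sqdist01 sqdist02 sqdist12 !mud3E /= /circ3 /Gam /rhombus_circ /=.
by rewrite !mul1r.
Qed.

Lemma is_fderiv_dham x : hdomain x -> is_fderiv Gam x (dham x).
Proof.
move=> /hdomainE [[h0 h1 h2] [h3 h4 h5]] nu.
rewrite innerK_vK.
have lnL (a b : R) : 0 < a -> is_derive (0 : R) 1 (fun s : R => ln (a + s * b)) (b / a).
  move=> a0.
  have : is_derive (0 : R) 1 (fun s : R => a + s * b) b.
    apply: is_derive_eq (is_derive_fadd (is_derive_fcst _ _ _)
      (is_derive_fmul (is_derive_id _ _) (is_derive_fcst _ _ _))) _.
    by rewrite mulr0 add0r mulr1 add0r.
  by move/is_derive_fln; rewrite mul0r addr0; apply.
have -> : (fun s : R => ham Gam (x + s *: nu)) = fun s : R => - (4 * pi)^-1 *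
  (g * (ln (x.[: 0] + s * nu.[: 0]) + ln (x.[: 1] + s * nu.[: 1]) + g * ln (x.[: 2] + s * nu.[: 2]))
   + (ln ((x.[: 0] + x.[: 1] - 2 * x.[: 3]) + s * (nu.[: 0] + nu.[: 1] - 2 * nu.[: 3]))
      + g * ln ((x.[: 0] + x.[: 2] - 2 * x.[: 5]) + s * (nu.[: 0] + nu.[: 2] - 2 * nu.[: 5]))
      + g * ln ((x.[: 1] + x.[: 2] - 2 * x.[: 7]) + s * (nu.[: 1] + nu.[: 2] - 2 * nu.[: 7])))).
  apply/funext => s; rewrite hamE !mxE.
  by congr (_ * (_ + (ln _ + _ * ln _ + _ * ln _))); gen9 x; gen9 nu; ring.
have c a := is_derive_fcst a (0 : R) (1 : R).
have D := is_derive_fmul (c (- (4 * pi)^-1))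
 (is_derive_fadd
   (is_derive_fmul (c g) (is_derive_fadd (is_derive_fadd (lnL _ nu.[: 0] h0) (lnL _ nu.[: 1] h1))
      (is_derive_fmul (c g) (lnL _ nu.[: 2] h2))))
   (is_derive_fadd (is_derive_fadd (lnL _ (nu.[: 0] + nu.[: 1] - 2 * nu.[: 3]) h3)
      (is_derive_fmul (c g) (lnL _ (nu.[: 0] + nu.[: 2] - 2 * nu.[: 5]) h4)))
      (is_derive_fmul (c g) (lnL _ (nu.[: 1] + nu.[: 2] - 2 * nu.[: 7]) h5)))).
apply: is_derive_eq D _.
rewrite !mulr0 !addr0 /dham !mxE !inordK //= /invd.
have p0 : (pi : R) != 0 :> R by rewrite gt_eqF ?pi_gt0.
move: h0 h1 h2 h3 h4 h5; move: (pi : R) p0 => ppi p0; gen9 x; gen9 nu => *; field.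
by rewrite p0 !gt_eqF.
Qed.

(** Two candidates for the derivative differ by an element orthogonal to everything; tested against
    itself it gives a vanishing sum of squares with positive weights. *)
Lemma fderiv_dham x : hdomain x -> fderiv Gam x = dham x.
Proof.
move=> hx; have h := is_fderiv_dham hx.
have : is_fderiv Gam x (fderiv Gam x) by apply: getPex; exists (dham x).
move: (fderiv _ _) => D hD.
have {hD h} E nu : innerK (vK nu) (vK D) = innerK (vK nu) (vK (dham x)).
  by have [_ <-] := hD nu; have [_ <-] := h nu.
have {}E nu : innerK (vK nu) (vK (D - dham x)) = 0.
  by have := E nu; rewrite !innerK_vK !mxE; move: (dham x) => e; gen9 nu; gen9 D; gen9 e => ?; lra.
move: (E (D - dham x)); rewrite innerK_vK => E0.
apply/eqP; rewrite -subr_eq0; apply/eqP; apply/row9P.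
move: (D - dham x) E0 => y.
move=> E0 k k9; rewrite !mxE.
suff : y.[: k] ^+ 2 <= 0 by move=> h; apply/eqP; rewrite -sqrf_eq0; apply/eqP/le_anti; rewrite h sqr_ge0.
move: k k9 => [|[|[|[|[|[|[|[|[|//]]]]]]]]] _; move: E0; gen9 y; rewrite -!expr2 => E0;
  have S := @sqr_ge0 R; have := (S y0, S y1, S y2, S y3, S y4, S y5, S y6, S y7, S y8);
  move: E0; move: (y0 ^+ 2) (y1 ^+ 2) (y2 ^+ 2) (y3 ^+ 2) (y4 ^+ 2) (y5 ^+ 2) (y6 ^+ 2) (y7 ^+ 2) (y8 ^+ 2);
  move=> ? ? ? ? ? ? ? ? ? ? [[[[[[[[? ?] ?] ?] ?] ?] ?] ?] ?]; lra.
Qed.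

(** Sherman-Morrison: [Kmx] is minus the diagonal matrix of the circulations plus a rank-one matrix,
    so its inverse is minus the diagonal of the reciprocals minus a constant matrix with entries
    [1 / Gamma_4], that is [g^-1]. *)
Definition Kinv : 'M[R]_3 := \matrix_(i, j)
  - ((if i == j then (circ3 Gam i)^-1 else 0) + g^-1).

Lemma invmx_Kmx : g != 0 -> 1 + g != 0 -> invmx (Kmx Gam) = Kinv.
Proof.
move=> g0 g1.
have KK : Kinv *m Kmx Gam = 1%:M.
  have tot : totcirc Gam = 2 * (1 + g).
    rewrite /totcirc !big_ord_recl big_ord0 /Gam /rhombus_circ /=; ring.
  apply/matrixP => i j; rewrite mulmx3E !mxE tot.
  case: i => [[|[|[|//]]] ?]; case: j => [[|[|[|//]]] ?] //=;
  rewrite /circ3 /Gam /rhombus_circ /=; field; rewrite g0 ?g1 //.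
have u : Kmx Gam \in unitmx.
  by have [] := mulmx1_unit KK.
by rewrite -[LHS]mul1mx -KK -mulmxA mulmxV // mulmx1.
Qed.

(* [relM] is [2 pi K^-1 (dh/dmu)] and [rateM M] lists the coordinates of
   [i (M A - A M^T)]. *)
Definition relM (r1 r2 r3 r12 r13 r23 : R) (i j : nat) : R :=
  nth 0 (nth [::]
   [:: [:: (1 + g) * r1 + r12 + g * r13; r2 - r12; g * (r3 - r13)];
       [:: r1 - r12; (1 + g) * r2 + r12 + g * r23; g * (r3 - r23)];
       [:: r1 - r13; r2 - r23; 2 * g * r3 + r13 + r23]] i) j.

Definition rateM (M : nat -> nat -> R) (x : 'rV[R]_9) : seq R :=
  [:: 2 * (M 0%N 1%N * x.[: 4] + M 0%N 2%N * x.[: 6]);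
      2 * (M 1%N 2%N * x.[: 8] - M 1%N 0%N * x.[: 4]);
      - 2 * (M 2%N 0%N * x.[: 6] + M 2%N 1%N * x.[: 8]);
      M 0%N 2%N * x.[: 8] + M 1%N 1%N * x.[: 4] + M 1%N 2%N * x.[: 6] - M 0%N 0%N * x.[: 4];
      M 0%N 0%N * x.[: 3] + M 0%N 1%N * x.[: 1] + M 0%N 2%N * x.[: 7]
        - M 1%N 0%N * x.[: 0] - M 1%N 1%N * x.[: 3] - M 1%N 2%N * x.[: 5];
      M 2%N 1%N * x.[: 4] + M 2%N 2%N * x.[: 6] - M 0%N 0%N * x.[: 6] - M 0%N 1%N * x.[: 8];
      M 0%N 0%N * x.[: 5] + M 0%N 1%N * x.[: 7] + M 0%N 2%N * x.[: 2]
        - M 2%N 0%N * x.[: 0] - M 2%N 1%N * x.[: 3] - M 2%N 2%N * x.[: 5];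
      M 2%N 2%N * x.[: 8] - M 1%N 0%N * x.[: 6] - M 1%N 1%N * x.[: 8] - M 2%N 0%N * x.[: 4];
      M 1%N 0%N * x.[: 5] + M 1%N 1%N * x.[: 7] + M 1%N 2%N * x.[: 2]
        - M 2%N 0%N * x.[: 3] - M 2%N 1%N * x.[: 1] - M 2%N 2%N * x.[: 7]].

Definition rate x : seq R :=
  invd x (fun r1 r2 r3 r12 r13 r23 => rateM (relM r1 r2 r3 r12 r13 r23) x).

Lemma Xh_rate x k : g != 0 -> 1 + g != 0 -> hdomain x -> (k < 9)%N ->
  (Xh Gam x).[: k] = (2 * pi)^-1 * nth 0 (rate x) k.
Proof.
move=> g0 g1 hx k9; rewrite /Xh /Xmx fderiv_dham // invmx_Kmx //.
have K3 : (((map_mx (real_complex R) Kinv) 0 0 = (- (1 + g^-1))%:C%C) *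
  ((map_mx (real_complex R) Kinv) 1 1 = (- (1 + g^-1))%:C%C) *
  ((map_mx (real_complex R) Kinv) 2 2 = (- (g^-1 + g^-1))%:C%C) *
  ((map_mx (real_complex R) Kinv) 0 1 = (- g^-1)%:C%C) *
  ((map_mx (real_complex R) Kinv) 0 2 = (- g^-1)%:C%C) *
  ((map_mx (real_complex R) Kinv) 1 2 = (- g^-1)%:C%C) *
  ((map_mx (real_complex R) Kinv) 1 0 = (- g^-1)%:C%C) *
  ((map_mx (real_complex R) Kinv) 2 0 = (- g^-1)%:C%C) *
  ((map_mx (real_complex R) Kinv) 2 1 = (- g^-1)%:C%C))%type.
  by do !split; rewrite !mxE /= /circ3 /Gam /rhombus_circ /= ?invr1 ?add0r.
move: K3; move: (map_mx (real_complex R) Kinv) => K K3.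
have hd : dham x = \row_k (- (2 * pi)^-1 * nth 0 (invd x lap6) k) by [].
have {hd} hd i : (i < 9)%N -> (dham x).[: i] = - (2 * pi)^-1 * nth 0 (invd x lap6) i.
  by move=> i9; rewrite hd mxE inordK.
have := vKE x; have := vKE (dham x); rewrite !hd //= => hB hA.
rewrite vKcoordE // /rate; move: hB; rewrite /invd /lap6 /rateM /relM /=.
move: (vK x) (vK (dham x)) hA => A B hA.
move: (x.[: 0]^-1) (x.[: 1]^-1) (x.[: 2]^-1) (x.[: 0] + x.[: 1] - 2 * x.[: 3])^-1
    (x.[: 0] + x.[: 2] - 2 * x.[: 5])^-1 (x.[: 1] + x.[: 2] - 2 * x.[: 7])^-1
  => r1 r2 r3 r12 r13 r23 hB.
have hM i j : (- (A *m B *m K) + K *m B *m A) i j = - ((A *m B *m K) i j) + (K *m B *m A) i j.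
  by rewrite !mxE.
rewrite !hM !mulmx3E !K3 !hA !hB /=.
have p0 : (pi : R) != 0 by rewrite gt_eqF ?pi_gt0.
move: (pi : R) p0 => ppi p0.
case: k k9 => [|[|[|[|[|[|[|[|[|//]]]]]]]]] _ /=; gen9 x; field; by rewrite p0 ?g0.
Qed.

End Equations.

(** * Differentiability at the equilibrium *)

Section Equilibrium.
Variables (R : realType) (g : R).

Lemma alphaA_root : alphaA g ^+ 2 = 3 * (1 - g) * alphaA g + g.
Proof.
(* The discriminant is [(3 g - 7/3)^2 + 32/9]. *)
have d0 : 0 <= 9 * (1 - g) ^+ 2 + 4 * g by have := sqr_ge0 (3 * g - 7 / 3); rewrite !expr2; lra.
have := sqr_sqrtr d0; rewrite /alphaA; move: (Num.sqrt _) => s hs.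
have -> : (2^-1 * (3 * (1 - g) + s)) ^+ 2 = (9 * (1 - g) ^+ 2 + 6 * (1 - g) * s + s ^+ 2) / 4 by field.
by rewrite hs; field.
Qed.

Lemma alphaA_gt1 : g < 1 -> 1 < alphaA g.
Proof.
move=> g1; rewrite /alphaA.
have : 3 * g - 1 < Num.sqrt (9 * (1 - g) ^+ 2 + 4 * g).
  have [h|h] := ltP (3 * g - 1) 0; first by rewrite (lt_le_trans h) ?sqrtr_ge0.
  (* The two squares differ by [8 (1 - g)]. *)
  rewrite -(ger0_norm h) -sqrtr_sqr ltr_sqrt; nra.
lra.
Qed.

Lemma mu0E (b : R) k : (k < 9)%N -> 0 <= b -> b ^+ 2 = alphaA g -> (mu0 g).[: k] =
  nth 0 [:: b ^+ 2 + 1; b ^+ 2 + 1; 4 * b ^+ 2; b ^+ 2 - 1;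
            - 2 * b; 2 * b ^+ 2; - 2 * b; 2 * b ^+ 2; 2 * b] k.
Proof.
move=> k9 b0 hb; rewrite /mu0 vKcoordE //.
have E i j : ('i%C *: (zA g *m (zA g) ^t* ))%sesqui i j = 'i%C * (zA g i 0 * ((zA g j 0)^*)%C).
  by rewrite mxE mxE big_ord1 !mxE.
have Z : ((zA g 0 0 = (1 +i* b)%C) * (zA g 1 0 = (- 1 +i* b)%C) *
   (zA g 2 0 = (0 +i* (2 * b)%R)%C))%type.
  by rewrite !mxE /rhombusA /= -hb !sqrtr_sqr !ger0_norm //; do !split; apply/eqP;
    rewrite eq_complex /=; apply/andP; split; apply/eqP; ring.
move: (zA g) Z E => z Z E; rewrite !E !Z /=.
by move: k k9 => [|[|[|[|[|[|[|[|[|//]]]]]]]]] _ /=; ring.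
Qed.

End Equilibrium.

Section Differentiability.
Variables (R : realType) (V : normedModType R).
Implicit Types (f h : V -> R) (x : V).

Lemma differentiable_fadd f h x : differentiable f x -> differentiable h x ->
  differentiable (fun y => f y + h y) x.
Proof. exact: differentiableD. Qed.

Lemma differentiable_fopp f x : differentiable f x -> differentiable (fun y => - f y) x.
Proof. exact: differentiableN. Qed.

Lemma differentiable_fmul f h x : differentiable f x -> differentiable h x ->
  differentiable (fun y => f y * h y) x.
Proof. exact: differentiableM. Qed.

End Differentiability.

Section Rate.
Variables (R : realType) (g : R).
Implicit Types x nu : 'rV[R]_9.

Lemma differentiable_rate k x : hdomain x -> (k < 9)%N ->
  differentiable (fun y => nth 0 (rate g y) k) x.
Proof.
move=> /hdomainE [[h0 h1 h2] [h3 h4 h5]] k9.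
have X i : differentiable (fun y : 'rV[R]_9 => y.[: i]) x by exact: differentiable_coord.
have C a : differentiable (fun y : 'rV[R]_9 => a : R) x by exact: differentiable_cst.
have A := @differentiable_fadd R 'rV[R]_9.
have N := @differentiable_fopp R 'rV[R]_9.
have M := @differentiable_fmul R 'rV[R]_9.
have I i : 0 < x.[: i] -> differentiable (fun y : 'rV[R]_9 => (y.[: i])^-1) x.
  by move=> h; apply: differentiableV => //; rewrite gt_eqF.
have J i j l : 0 < x.[: i] + x.[: j] - 2 * x.[: l] ->
    differentiable (fun y : 'rV[R]_9 => (y.[: i] + y.[: j] - 2 * y.[: l])^-1) x.
  by move=> h; apply: differentiableV; rewrite ?gt_eqF //; apply: A (A _ _ _ _ _) (N _ _ (M _ _ _ _ _)).
have I0 := I _ h0; have I1 := I _ h1; have I2 := I _ h2.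
have J3 := J _ _ _ h3; have J4 := J _ _ _ h4; have J5 := J _ _ _ h5.
rewrite /rate /invd /relM /rateM.
move: k k9 => [|[|[|[|[|[|[|[|[|//]]]]]]]]] _ /=;
  do ?[exact: X|exact: C|exact: I0|exact: I1|exact: I2|exact: J3|exact: J4|exact: J5
      |apply: (M)|apply: (N)|apply: (A)].
Qed.

Lemma hdomain_open x : hdomain x -> \forall y \near x, hdomain y.
Proof.
move=> /hdomainE [[h0 h1 h2] [h3 h4 h5]].
have X i : continuous (fun y : 'rV[R]_9 => y.[: i]) by move=> y; exact: differentiable_continuous (differentiable_coord _ _ _).
have J i j l : continuous (fun y : 'rV[R]_9 => y.[: i] + y.[: j] - 2 * y.[: l]).
  have Y k z : differentiable (fun y : 'rV[R]_9 => y.[: k]) z by exact: differentiable_coord.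
  move=> z; apply: differentiable_continuous.
  apply: (differentiable_fadd (differentiable_fadd (Y _ _) (Y _ _))).
  apply: differentiable_fopp; apply: differentiable_fmul (Y _ _).
  exact: differentiable_cst.
near=> y; apply/hdomainE; split; split; near: y.
- exact: (cvgr_gt _ (X 0%N x) _ h0).
- exact: (cvgr_gt _ (X 1%N x) _ h1).
- exact: (cvgr_gt _ (X 2%N x) _ h2).
- exact: (cvgr_gt _ (J _ _ _ x) _ h3).
- exact: (cvgr_gt _ (J _ _ _ x) _ h4).
- exact: (cvgr_gt _ (J _ _ _ x) _ h5).
Unshelve. all: by end_near. Qed.

Lemma near_Xh_rate x : g != 0 -> 1 + g != 0 -> hdomain x ->
  \forall y \near x, Xh (rhombus_circ g) y =
     \row_(k < 9) ((2 * pi)^-1 * nth 0 (rate g y) k).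
Proof.
move=> g0 g1 hx; have := hdomain_open hx; apply: filterS => y hy.
by apply/row9P => k k9; rewrite Xh_rate // mxE inordK.
Qed.

Lemma differentiable_Xh x : g != 0 -> 1 + g != 0 -> hdomain x ->
  differentiable (Xh (rhombus_circ g)) x.
Proof.
move=> g0 g1 hx; apply: near_eq_differentiable (near_Xh_rate g0 g1 hx) _.
apply: differentiable_row => k; apply: differentiable_fmul.
  exact: differentiable_cst.
exact: differentiable_rate.
Qed.

End Rate.

(** * The unstable direction *)

Section HasDerivative.
Variables (R : realType) (V : normedModType R).
Implicit Types (f h : V -> R) (x v : V).

(* A copy of [is_derive] that is not a class, so that [apply] leaves the value
   of the derivative to unification. *)
Definition has_deriv f x v (df : R) : Prop := is_derive x v f df.

Lemma has_deriv_cst a x v : has_deriv (fun=> a) x v 0.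
Proof. exact: is_derive_fcst. Qed.

Lemma has_derivD f h x v df dh : has_deriv f x v df -> has_deriv h x v dh ->
  has_deriv (fun y => f y + h y) x v (df + dh).
Proof. exact: is_derive_fadd. Qed.

Lemma has_derivN f x v df : has_deriv f x v df -> has_deriv (fun y => - f y) x v (- df).
Proof. exact: is_derive_fopp. Qed.

Lemma has_derivM f h x v df dh : has_deriv f x v df -> has_deriv h x v dh ->
  has_deriv (fun y => f y * h y) x v (f x * dh + h x * df).
Proof. exact: is_derive_fmul. Qed.

Lemma has_derivV f x v df : has_deriv f x v df -> f x != 0 ->
  has_deriv (fun y => (f y)^-1) x v (- df / (f x) ^+ 2).
Proof.
move=> [d <-] fx; split; first exact: derivableV.
by rewrite (deriveV fx d) /GRing.scale /= mulNr mulNr mulrC.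
Qed.

End HasDerivative.

Lemma has_deriv_coord (R : realType) n (x v : 'rV[R]_n) i :
  has_deriv (fun y : 'rV[R]_n => y ord0 i) x v (v ord0 i).
Proof.
have d : derivable (@id 'rV[R]_n) x v by exact: derivable_id.
split; first by move/derivable_mxP: d; apply.
by have := derive_mx d; rewrite derive_id => /rowP /(_ i); rewrite mxE => <-.
Qed.

Section Eigenvector.
Variables (R : realType) (b m : R).

Let g := b ^+ 2 * (3 - b ^+ 2) / (3 * b ^+ 2 - 1).
Let S := 1 + b ^+ 2.
(** Half the eigenvalue of the linearized [rate]. It is forced by the coordinate [|b|^2], where the
    entry of [unstable_dir] is 1 and the linearization gives [- 8 b m / S^2]. *)
Let l := - 4 * b * m / S ^+ 2.
(** Linearization of [|a|^2 |b|^2 = |a b^*|^2] at the equilibrium, where [|a|^2 = 4],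
    [|b|^2 = 4 b^2] and [a b^* = - 4 i b]: the increments [- g] and 1 of the two squares give
    [4 - 4 b^2 g = - 8 b n]. *)
Let n := - (1 - b ^+ 2 * g) / (2 * b).

Definition equilibrium : 'rV[R]_9 := \row_k
  nth 0 [:: b ^+ 2 + 1; b ^+ 2 + 1; 4 * b ^+ 2; b ^+ 2 - 1;
            - 2 * b; 2 * b ^+ 2; - 2 * b; 2 * b ^+ 2; 2 * b] k.

(* Tangent to [c = 0] and to the level set of the impulse:
   [d|a|^2 = - g], [d|b|^2 = 1], [d Re (a b^* ) = m], [d Im (a b^* ) = n]. *)
Definition unstable_dir : 'rV[R]_9 := \row_k
  nth 0 [:: ((1 - g) / 4 + m / 2); ((1 - g) / 4 - m / 2); 1; (1 + g) / 4; n / 2;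
     (1 + m) / 2; n / 2; (1 - m) / 2; - n / 2] k.

(** The prescribed value of [m ^+ 2] is what makes the direction an eigenvector. It is [- 2 S^2]
    times the coefficient shown positive in [kpq_gt0], so instability begins where that coefficient
    changes sign. *)
Lemma has_deriv_rate k : (k < 9)%N -> 1 < b ->
  m ^+ 2 = - (g * (1 + b ^- 4) * S ^+ 2 + 4 * (1 - g) ^+ 2) / 16 ->
  has_deriv (fun y => nth 0 (rate g y) k) equilibrium unstable_dir
    (2 * l * unstable_dir.[: k]).
Proof.
move=> k9 b1 hm.
have b0 : b != 0 by rewrite gt_eqF //; lra.
have b2 : 1 < b ^+ 2 by nra.
have d0 : 3 * b ^+ 2 - 1 != 0 by rewrite gt_eqF //; lra.
have S0 : b ^+ 2 + 1 != 0 by rewrite gt_eqF //; lra.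
have E i (i9 : (i < 9)%N) : equilibrium.[: i] = _ := row9E _ i9.
have U i (i9 : (i < 9)%N) : unstable_dir.[: i] = _ := row9E _ i9.
have s01 : equilibrium.[: 0] + equilibrium.[: 1] - 2 * equilibrium.[: 3] = 4.
  by rewrite !E //=; ring.
have s02 : equilibrium.[: 0] + equilibrium.[: 2] - 2 * equilibrium.[: 5] = b ^+ 2 + 1.
  by rewrite !E //=; ring.
have s12 : equilibrium.[: 1] + equilibrium.[: 2] - 2 * equilibrium.[: 7] = b ^+ 2 + 1.
  by rewrite !E //=; ring.
move: equilibrium unstable_dir E U s01 s02 s12 => x v E U s01 s02 s12.
suff [d [dk <-]] : exists d, has_deriv (fun y => nth 0 (rate g y) k) x v d /\
    d = 2 * l * v.[: k] by [].
rewrite /rate /invd /relM /rateM.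
have X i := has_deriv_coord x v (inord i).
have C := @has_deriv_cst R 'rV[R]_9.
have A := @has_derivD R 'rV[R]_9.
have N := @has_derivN R 'rV[R]_9.
have M := @has_derivM R 'rV[R]_9.
have I i : x.[: i] != 0 -> has_deriv (fun y : 'rV[R]_9 => (y.[: i])^-1) x v (- v.[: i] / x.[: i] ^+ 2).
  by move=> h; apply: has_derivV.
have J i j q : x.[: i] + x.[: j] - 2 * x.[: q] != 0 ->
   has_deriv (fun y : 'rV[R]_9 => (y.[: i] + y.[: j] - 2 * y.[: q])^-1) x v
     (- (v.[: i] + v.[: j] - 2 * v.[: q]) / (x.[: i] + x.[: j] - 2 * x.[: q]) ^+ 2).
  move=> h; apply: has_derivV => //; apply: (A); first exact: A.
  by apply: N; have := M _ _ _ _ _ _ (C 2 x v) (X q); rewrite mulr0 addr0.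
have I0 := I 0%N; have I1 := I 1%N; have I2 := I 2%N.
have J3 := J 0%N 1%N 3%N; have J4 := J 0%N 2%N 5%N; have J5 := J 1%N 2%N 7%N.
rewrite !E //= in I0 I1 I2; rewrite s01 in J3; rewrite s02 in J4; rewrite s12 in J5.
have b4 : 4 * b ^+ 2 != 0 by rewrite mulf_neq0 ?expf_neq0 // lt0r_neq0.
have n4 : (4 : R) != 0 by rewrite lt0r_neq0.
move: (I0 S0) (I1 S0) (I2 b4) (J3 n4) (J4 S0) (J5 S0) => K0 K1 K2 K3 K4 K5.
case: k k9 => [|[|[|[|[|[|[|[|[|//]]]]]]]]] _ /=; eexists; (split; [
  do ?[exact: X|exact: C|exact: K0|exact: K1|exact: K2|exact: K3|exact: K4|exact: K5
      |apply: (M)|apply: (N)|apply: (A)]|]).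
all: rewrite /= ?s01 ?s02 ?s12 ?[x.[: _]]E ?U //=.
all: clear -hm b0 d0 S0 n4 b4.
all: have Sn : S != 0 by rewrite /S addrC.
(* The square of [m] occurs only through the product [l * m], which the hypothesis on [m ^+ 2] turns
   into a rational function of [b]; what is left is affine in [m]. *)
all: have lm : l * m = b / 4 * (g * (1 + b ^- 4) + 4 * (1 - g) ^+ 2 / S ^+ 2).
all: try by have -> : l * m = - 4 * b / S ^+ 2 * m ^+ 2; [rewrite /l; field|rewrite hm; field; rewrite ?Sn ?b0].
all: have D0 : 2 * l * ((1 - g) / 4 + m / 2) = l * (1 - g) / 2 + l * m by field.
all: have D1 : 2 * l * ((1 - g) / 4 - m / 2) = l * (1 - g) / 2 - l * m by field.
all: have D2 : 2 * l * ((1 + m) / 2) = l + l * m by field.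
all: have D3 : 2 * l * ((1 - m) / 2) = l - l * m by field.
all: rewrite ?D0 ?D1 ?D2 ?D3 ?lm; clear D0 D1 D2 D3 lm hm Sn b4 n4.
all: rewrite /n /l /S /g; field; by rewrite addrC S0 d0 b0 || by rewrite d0 addrC S0 b0 || by rewrite b0 d0 addrC S0.
Qed.
End Eigenvector.

(** * The threshold in terms of alpha, and linear instability *)

Section RhombusParameter.
Variables (R : realType) (g : R).

Lemma alphaA_param : g < 1 -> 3 * alphaA g - 1 != 0 /\
  g = alphaA g * (3 - alphaA g) / (3 * alphaA g - 1).
Proof.
move=> g1; have a1 := alphaA_gt1 g1; have h := alphaA_root g.
have d0 : 3 * alphaA g - 1 != 0 by rewrite gt_eqF //; lra.
by split=> //; apply: (mulIf d0); rewrite divfK //; move: (alphaA g) h => a; rewrite !expr2; lra.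
Qed.

(* [alpha + 1/alpha = 4] is the image of the threshold [g = -2 + sqrt 3]. *)
Lemma alphaA_threshold : -1 < g < 1 ->
  (0 < alphaA g ^+ 2 - 4 * alphaA g + 1) = (g ^+ 2 + 4 * g + 1 < 0) /\
  (alphaA g ^+ 2 - 4 * alphaA g + 1 < 0) = (0 < g ^+ 2 + 4 * g + 1).
Proof.
move=> /andP[gN1 g1]; have a1 := alphaA_gt1 g1; have h := alphaA_root g.
have [d0 E] := alphaA_param g1.
(* Since [g > -1], [alpha^2 = 3 alpha - g (3 alpha - 1) < 6 alpha - 1]. *)
have n0 : alphaA g ^+ 2 - 14 * alphaA g + 1 < 0 by nra.
(* The first factor has its root above 1 at [g = -2 + sqrt 3], the second at the other root
   [-2 - sqrt 3], outside the admissible range. *)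
have P : (3 * alphaA g - 1) ^+ 2 * (g ^+ 2 + 4 * g + 1) =
   (alphaA g ^+ 2 - 4 * alphaA g + 1) * (alphaA g ^+ 2 - 14 * alphaA g + 1).
  move: E d0; move: (alphaA g) => a -> d0; field.
  by rewrite d0.
have d2 : 0 < (3 * alphaA g - 1) ^+ 2 by rewrite exprn_even_gt0.
split.
  by rewrite -(pmulr_rlt0 _ d2) P nmulr_llt0.
by rewrite -(pmulr_rgt0 _ d2) P nmulr_lgt0.
Qed.

Lemma threshold_lt : -1 < g -> (g < -2 + Num.sqrt 3) = (g ^+ 2 + 4 * g + 1 < 0).
Proof.
move=> g1; have -> : (g < -2 + Num.sqrt 3) = (g + 2 < Num.sqrt 3) by rewrite addrC ltrBrDr.
have g2 : 0 <= g + 2 by lra.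
rewrite -[in LHS](ger0_norm g2) -sqrtr_sqr ltr_sqrt; last by lra.
by apply/idP/idP; rewrite !expr2 => ?; lra.
Qed.

Lemma threshold_gt : -1 < g -> (-2 + Num.sqrt 3 < g) = (0 < g ^+ 2 + 4 * g + 1).
Proof.
move=> g1; have -> : (-2 + Num.sqrt 3 < g) = (Num.sqrt 3 < g + 2) by rewrite [- 2 + _]addrC ltrBlDr.
have g2 : 0 <= g + 2 by lra.
rewrite -[in LHS](ger0_norm g2) -sqrtr_sqr ltr_sqrt; last by rewrite exprn_even_gt0 //= gt_eqF //; lra.
by apply/idP/idP; rewrite !expr2 => ?; lra.
Qed.

Lemma mu0_equilibrium (b : R) : 0 <= b -> b ^+ 2 = alphaA g -> mu0 g = equilibrium b.
Proof. by move=> b0 hb; apply/row9P => k k9; rewrite (mu0E k9 b0 hb) row9E. Qed.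

Lemma hdomain_equilibrium (b : R) : 0 < b -> hdomain (equilibrium b).
Proof.
move=> b0; apply/hdomainE; rewrite !row9E //=.
have b2 : 0 < b ^+ 2 by rewrite exprn_gt0.
by split; split; lra.
Qed.

Lemma rhombusA_unstable : -1 < g -> g < -2 + Num.sqrt 3 ->
  linearly_unstable (Xh (rhombus_circ g)) (mu0 g).
Proof.
move=> gN1 gt; have hg := gt; rewrite (threshold_lt gN1) in hg.
have g1 : g < 1 by nra.
have g0 : g < 0 by nra.
have a1 := alphaA_gt1 g1.
have [b b1 hb] : exists2 b : R, 1 < b & b ^+ 2 = alphaA g.
  exists (Num.sqrt (alphaA g)); last by rewrite sqr_sqrtr //; lra.
  by rewrite -sqrtr1 ltr_sqrt //; lra.
have b0 : 0 < b by lra.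
rewrite (mu0_equilibrium (ltW b0) hb).
have hx := hdomain_equilibrium b0.
have gn0 : g != 0 by lra.
have gn1 : 1 + g != 0 by rewrite gt_eqF //; lra.
have dX := differentiable_Xh gn0 gn1 hx.
split=> //.
have g11 : -1 < g < 1 by rewrite gN1 g1.
have [thr _] := alphaA_threshold g11; rewrite hg in thr.
have [d0 E] := alphaA_param g1.
rewrite -hb in thr d0 E.
set q := - (g * (1 + b ^- 4) * (1 + b ^+ 2) ^+ 2 + 4 * (1 - g) ^+ 2) / 16.
(* In terms of [b] the quantity [q] factors, and the only factor whose sign depends on the range of
   [g] is [alpha^2 - 4 alpha + 1]. *)
have q0 : 0 < q.
  have -> : q = (1 + b ^+ 2) ^+ 2 * (3 * b ^+ 4 - 2 * b ^+ 2 + 3) * (b ^+ 4 - 4 * b ^+ 2 + 1)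
      / (16 * b ^+ 2 * (3 * b ^+ 2 - 1) ^+ 2).
    rewrite /q E; field; rewrite d0 gt_eqF //.
  have e4 : b ^+ 4 = (b ^+ 2) ^+ 2 by rewrite -exprM.
  apply: divr_gt0; last first.
    have b2 : 1 < b ^+ 2 by nra.
    by rewrite mulr_gt0 ?mulr_gt0 ?exprn_gt0 //; lra.
  have S0 : 0 < 1 + b ^+ 2 by rewrite ltr_wpDr ?sqr_ge0.
  apply: mulr_gt0; last by rewrite e4 thr.
  apply: mulr_gt0; first exact: exprn_gt0.
  by rewrite e4; have := sqr_ge0 (b ^+ 2 - 1); have := sqr_ge0 (b ^+ 2); rewrite !expr2; lra.
(* The linearization has both square roots as solutions, with opposite eigenvalues; the negative one
   makes [l] positive. *)
set m := - Num.sqrt q.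
have m0 : m < 0 by rewrite oppr_lt0 sqrtr_gt0.
have hm : m ^+ 2 = q by rewrite /m sqrrN sqr_sqrtr // ltW.
set l := - 4 * b * m / (1 + b ^+ 2) ^+ 2.
have l0 : 0 < l.
  rewrite /l divr_gt0 ?exprn_gt0 ?ltr_wpDr ?sqr_ge0 //; nra.
exists (l / pi)%:C%C; first by rewrite /= divr_gt0 ?pi_gt0.
set v := unstable_dir b m.
have D : 'D_v (Xh (rhombus_circ g)) (equilibrium b) = (l / pi) *: v.
  rewrite (near_eq_derive _ (near_Xh_rate gn0 gn1 hx)).
  have dr : differentiable (fun y => \row_(k < 9) ((2 * pi)^-1 * nth 0 (rate g y) k)) (equilibrium b).
    apply: differentiable_row => k; apply: differentiable_fmul; last exact: differentiable_rate.
    exact: differentiable_cst.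
  rewrite derive_mx; last exact: diff_derivable.
  apply/row9P => k k9; rewrite [LHS]mxE [RHS]mxE.
  have := has_deriv_rate k9 b1; rewrite -/(q) -E => /(_ _ hm) H.
  have [_ HH] := is_derive_fmul (is_derive_fcst (2 * pi)^-1 (equilibrium b) v) H.
  have Ef : (fun y : 'rV[R]_9 => (\row_(k < 9) ((2 * pi)^-1 * nth 0 (rate g y) k)) ord0 (inord k))
      = (fun y : 'rV[R]_9 => (2 * pi)^-1 * nth 0 (rate g y) k).
    by apply/funext => y; rewrite mxE inordK.
  rewrite [X in X = _](_ : _ = (2 * pi)^-1 * (2 * l * v.[: k])); last first.
    by rewrite Ef HH mulr0 addr0.
  have p0 : (pi : R) != 0 by rewrite gt_eqF ?pi_gt0.
  by move: (pi : R) p0 (v.[: k]) => p p0 w; field.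
(* The derivative along [v] is the row [v] times the Jacobian matrix, so [v] is an eigenvector on
   the side that [eigenvalue] expects. *)
apply/eigenvalueP; exists (map_mx (real_complex R) v).
  by rewrite -map_mxM -deriveEjacobian // D map_mxZ.
rewrite map_mx_eq0; apply/eqP => /rowP /(_ (inord 2)).
by rewrite /v row9E //= mxE => /eqP; rewrite oner_eq0.
Qed.

End RhombusParameter.

(** * The Lyapunov function near the equilibrium *)

Section Estimates.
Variable R : realType.
Implicit Types x e : R.

(** The remainder vanishes at 0 and has derivative [y^2 / (1 + y)], at most [2 x^2] between 0 and
    [x] because [1 + y >= 1/2]; the mean value theorem concludes. *)
Lemma ln1D_taylor2 x : `|x| <= 1 / 2 ->
  `|ln (1 + x) - (x - x ^+ 2 / 2)| <= 2 * `|x| ^+ 3.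
Proof.
move=> hx.
pose f (y : R) := ln (1 + y) - (y - y ^+ 2 / 2).
have f0 : f 0 = 0 by rewrite /f addr0 ln1 expr0n /= mul0r !subr0.
have df (y : R) : `|y| <= `|x| -> is_derive y 1 f (y ^+ 2 / (1 + y)).
  move=> yx; have y1 : 0 < 1 + y.
    by have := le_trans yx hx; rewrite ler_norml => /andP[]; lra.
  have c a := is_derive_fcst a y (1 : R); have i := is_derive_id y (1 : R).
  have D := is_derive_fadd (is_derive_fln (f := fun z => 1 + z) y1 (is_derive_fadd (c 1) i))
     (is_derive_fopp (is_derive_fadd i (is_derive_fopp (is_derive_fmul (is_derive_fsqr i) (c 2^-1))))).
  apply: is_derive_eq D _; field; by rewrite gt_eqF.
have key (s t : R) : s <= t -> (forall y, s <= y <= t -> `|y| <= `|x|) ->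
    `|f t - f s| <= 2 * `|x| ^+ 2 * (t - s).
  move=> st hst.
  have dst (y : R) : y \in `]s, t[%R -> is_derive y 1 f (y ^+ 2 / (1 + y)).
    by rewrite in_itv /= => /andP[/ltW sy /ltW yt]; apply: df; apply: hst; rewrite sy yt.
  have cst : {within `[s, t], continuous f}.
    apply: derivable_within_continuous => y; rewrite in_itv /= => hy.
    by apply: ex_derive; apply: df; exact: hst.
  have [y + ->] := MVT_segment st dst cst.
  rewrite in_itv /= => hy; have yx := hst _ hy.
  have y1 : 1 / 2 <= 1 + y.
    by have := le_trans yx hx; rewrite ler_norml => /andP[]; lra.
  rewrite normrM [`|t - s|]ger0_norm ?subr_ge0 // ler_wpM2r ?subr_ge0 //.
  have y0 : 0 < 1 + y by lra.
  rewrite normrM normrX normfV [`|1 + y|]gtr0_norm // ler_pdivrMr //.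
  have : `|y| ^+ 2 <= `|x| ^+ 2 by rewrite lerXn2r ?nnegrE.
  have := sqr_ge0 `|x|; nra.
have [x0|x0] := leP 0 x.
  have := key 0 x x0; rewrite f0 !subr0 => h.
  rewrite -/(f x); apply: le_trans (h _) _.
    by move=> y /andP[y0 yx]; rewrite !ger0_norm.
  by rewrite (ger0_norm x0) -mulrA -exprSr.
have := key x 0 (ltW x0); rewrite f0 !sub0r normrN => h.
rewrite -/(f x); apply: le_trans (h _) _.
  by move=> y /andP[xy y0]; rewrite !ler0_norm ?lerN2 // ltW.
by rewrite (ltr0_norm x0) -mulrA -exprSr.
Qed.

(** The cubic remainder is recast as a small multiple of the square, the form in which it can be
    absorbed by a definite quadratic form. *)
Lemma ln1D_bound x e : `|x| <= e -> e <= 1 / 2 ->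
  exists2 t, `|t| <= 2 * e * x ^+ 2 & ln (1 + x) = x - x ^+ 2 / 2 + t.
Proof.
move=> xe e2; exists (ln (1 + x) - (x - x ^+ 2 / 2)); last by ring.
apply: le_trans (ln1D_taylor2 (le_trans xe e2)) _.
have := ler_wpM2r (sqr_ge0 x) xe.
by rewrite -[x ^+ 2]real_normK ?num_real // -exprS => ?; lra.
Qed.

(** Finsler's lemma in two variables: a form positive on the line [s = 0] becomes definite once a
    large multiple of [s^2] is added. Half of [k t^2] is kept, the other half absorbs the cross term
    by completing a square at the cost of [2 B^2 / k] on [s^2]. *)
Lemma quad_penalty (A B k : R) : 0 < k -> exists c kap, [/\ 0 < c, 0 <= kap &
  forall s t, c * (s ^+ 2 + t ^+ 2) <= A * s ^+ 2 + 2 * B * s * t + k * t ^+ 2 + kap * s ^+ 2].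
Proof.
move=> k0; exists (k / 2), (`|A| + 2 * B ^+ 2 / k + k / 2); split; first by lra.
  have : 0 <= B ^+ 2 / k by rewrite divr_ge0 ?sqr_ge0 // ltW.
  by have := normr_ge0 A; rewrite -mulrA; lra.
move=> s t.
have h1 : 0 <= (A + `|A|) * s ^+ 2.
  by rewrite mulr_ge0 ?sqr_ge0 //; have := ler_norm (- A); rewrite normrN; lra.
have h2 : 0 <= (k / 2) * (t + 2 * B / k * s) ^+ 2 by rewrite mulr_ge0 ?sqr_ge0 //; lra.
have E : (k / 2) * (t + 2 * B / k * s) ^+ 2 = k / 2 * t ^+ 2 + 2 * B * s * t + 2 * B ^+ 2 / k * s ^+ 2.
  by field; rewrite gt_eqF.
rewrite E in h2; rewrite mulrDl in h1.
move: h1 h2; rewrite !mulrDl !mulrDr; lra.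
Qed.

Lemma cauchy2 (m n u v : R) : (m * u + n * v) ^+ 2 <= (m ^+ 2 + n ^+ 2) * (u ^+ 2 + v ^+ 2).
Proof.
rewrite -subr_ge0 (_ : _ - _ = (m * v - n * u) ^+ 2) ?sqr_ge0 //; ring.
Qed.

End Estimates.

(** * Elementary estimates from the rank-one relations near the equilibrium *)

Section RankOneBounds.
Variable R : realType.
Implicit Types p l m n u v w e b c k d s x y g : R.

(** Here [p], [l] and [u + i v] stand for [|a|^2], [|c|^2] and [a c^*]. As [p] is close to 4, [l] is
    a quarter of [u^2 + v^2] up to a small relative error; in particular it is of second order. *)
Lemma rank1_l_bounds p l u v e : `|p - 4| <= e -> e <= 1 -> `|l| <= e ->
  p * l = u ^+ 2 + v ^+ 2 ->
  [/\ 0 <= l, l <= u ^+ 2 + v ^+ 2 & `|4 * l - (u ^+ 2 + v ^+ 2)| <= e * (u ^+ 2 + v ^+ 2)].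
Proof.
move=> hp e1 hl E.
have [p3 p5] : 3 <= p /\ p <= 5 by move: hp; rewrite ler_norml => /andP[]; lra.
have uv0 : 0 <= u ^+ 2 + v ^+ 2 by rewrite addr_ge0 ?sqr_ge0.
have p0 : 0 < p by lra.
have l0 : 0 <= l by rewrite -(pmulr_rge0 _ p0) E.
have l1 : l <= u ^+ 2 + v ^+ 2 by rewrite -E; nra.
split=> //; rewrite -E (_ : 4 * l - p * l = - ((p - 4) * l)); last by ring.
rewrite normrN normrM (ger0_norm l0) E.
exact: ler_pM.
Qed.

Lemma rank1_w_le p m n u v w c : 3 <= p -> `|m| <= 1 -> `|n| <= c ->
  p * w = m * u + n * v -> w ^+ 2 <= (1 + c ^+ 2) * (u ^+ 2 + v ^+ 2).
Proof.
move=> p3 hm hn E.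
have := cauchy2 m n u v; rewrite -E.
have m1 : m ^+ 2 <= 1 by rewrite -[m ^+ 2]real_normK ?num_real // exprn_ile1.
have n1 : n ^+ 2 <= c ^+ 2 by rewrite -[n ^+ 2]real_normK ?num_real // lerXn2r ?nnegrE // (le_trans _ hn).
have uv0 : 0 <= u ^+ 2 + v ^+ 2 by rewrite addr_ge0 ?sqr_ge0.
have h : (m ^+ 2 + n ^+ 2) * (u ^+ 2 + v ^+ 2) <= (1 + c ^+ 2) * (u ^+ 2 + v ^+ 2).
  by rewrite ler_wpM2r // lerD.
move=> h2; apply: le_trans (le_trans h2 h); rewrite exprMn.
by rewrite ler_peMl ?sqr_ge0 //; nra.
Qed.

(** At the equilibrium [p = 4], [m = 0] and [n = - 4 b], so the relation reads [w = - b v] to first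
    order, and [w^2] contributes [b^2 v^2] up to an error of relative size [e]. *)
Lemma rank1_w_ge p m n u v w e b k : `|p - 4| <= e -> e <= 1 -> `|m| <= e ->
  1 <= b -> `|n + 4 * b| <= e -> p * w = m * u + n * v -> 0 <= k ->
  w ^+ 2 <= k * (u ^+ 2 + v ^+ 2) ->
  b ^+ 2 * v ^+ 2 - e * (b + 1 + k) * (u ^+ 2 + v ^+ 2) <= w ^+ 2.
Proof.
move=> hp e1 hm b1 hn E k0 hk.
have e0 : 0 <= e by apply: le_trans hm.
have [p1 p2] : 4 - e <= p /\ p <= 4 + e by move: hp; rewrite ler_norml => /andP[]; lra.
have [n1 n2] : - e - 4 * b <= n /\ n <= e - 4 * b by move: hn; rewrite ler_norml => /andP[]; lra.
have pp : p ^+ 2 <= 16 + 9 * e by nra.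
have nn : 16 * b ^+ 2 - 8 * b * e <= n ^+ 2 by nra.
have cross : - (e * (4 * b + 1) * (u ^+ 2 + v ^+ 2)) <= 2 * (m * n) * (u * v).
  have h1 : `|m * n| <= e * (4 * b + 1).
    rewrite normrM; apply: ler_pM => //; rewrite ler_norml; lra.
  have h2 : `|2 * (u * v)| <= u ^+ 2 + v ^+ 2.
    rewrite ler_norml; have := sqr_ge0 (u - v); have := sqr_ge0 (u + v).
    by rewrite !sqrrD !mulr2n sqrrN; lra.
  have := ler_pM (normr_ge0 _) (normr_ge0 _) h1 h2.
  rewrite -normrM ler_norml => /andP[h _].
  by rewrite (_ : 2 * (m * n) * (u * v) = m * n * (2 * (u * v))) //; ring.
have E2 : p ^+ 2 * w ^+ 2 = m ^+ 2 * u ^+ 2 + 2 * (m * n) * (u * v) + n ^+ 2 * v ^+ 2.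
  by rewrite -exprMn E; ring.
have h1 := ler_wpM2r (sqr_ge0 w) pp.
have h2 := ler_wpM2r (sqr_ge0 v) nn.
have h3 : 0 <= m ^+ 2 * u ^+ 2 by rewrite mulr_ge0 ?sqr_ge0.
have h4 := ler_wpM2l e0 hk.
have h5 : 0 <= e * b * u ^+ 2 by apply: mulr_ge0; [apply: mulr_ge0; lra|exact: sqr_ge0].
have h6 : 0 <= e * b * v ^+ 2 by apply: mulr_ge0; [apply: mulr_ge0; lra|exact: sqr_ge0].
have h7 : 0 <= e * u ^+ 2 by apply: mulr_ge0 => //; exact: sqr_ge0.
have h8 : 0 <= e * v ^+ 2 by apply: mulr_ge0 => //; exact: sqr_ge0.
have h9 : 0 <= e * w ^+ 2 by apply: mulr_ge0 => //; exact: sqr_ge0.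
move: E2 h1 h2 h3 h4 h5 h6 h7 h8 h9 cross.
move: (u ^+ 2) (v ^+ 2) (w ^+ 2) (p ^+ 2) (n ^+ 2) (m ^+ 2) => U V W P N M.
rewrite !mulrDl !mulrDr !mulrDl; move: (2 * (m * n) * (u * v)) => X.
by rewrite !mulrA; lra.
Qed.

Lemma sqr_div_le x y : 1 <= y -> (x / y) ^+ 2 <= x ^+ 2.
Proof.
move=> y1; rewrite expr_div_n ler_pdivrMr; last by rewrite exprn_gt0 //; lra.
by rewrite ler_peMr ?sqr_ge0 // exprn_ege1.
Qed.

Lemma norm_combinations d u w m e :
  `|d| <= 3 / 2 * e -> `|u| <= e -> `|w| <= e -> `|m| <= e ->
  [/\ `|d + u - w - m / 2| <= 4 * e, `|d + u + w + m / 2| <= 4 * e,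
      `|d - u - w + m / 2| <= 4 * e & `|d - u + w - m / 2| <= 4 * e].
Proof.
rewrite !ler_norml => /andP[? ?] /andP[? ?] /andP[? ?] /andP[? ?].
by split; apply/andP; split; lra.
Qed.

Lemma norm_div_le2 x y e : 2 < y -> `|x| <= 4 * e -> `|x / y| <= 2 * e.
Proof.
move=> y2 hx; have y0 : 0 < y by lra.
have e0 : 0 <= e by have := le_trans (normr_ge0 x) hx; lra.
rewrite normrM normfV (gtr0_norm y0) ler_pdivrMr //.
by apply: le_trans hx _; have := ler_wpM2l e0 (ltW y2); lra.
Qed.

Lemma norm_div_le x y e : 1 <= y -> `|x| <= e -> `|x / y| <= e.
Proof.
move=> y1 hx; have y0 : 0 < y by lra.
rewrite normrM normfV (gtr0_norm y0) ler_pdivrMr //; apply: le_trans (hx) _.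
by rewrite ler_peMr // (le_trans _ hx).
Qed.

(** A quantity [l] that is both small and of the size of the squared distance [N] changes [s^2] only
    by a multiple of [e * N]. *)
Lemma sqrD_bounds l s e (N : R) : 0 <= l -> l <= e -> l <= N -> 0 <= N -> e <= 1 ->
  `|s| <= e / 2 -> s ^+ 2 <= N -> s ^+ 2 - e * N <= (l + s) ^+ 2 /\ (l + s) ^+ 2 <= 4 * N.
Proof.
move=> l0 le_l lN N0 eh hs s2.
have e0 : 0 <= e by exact: le_trans le_l.
have ll : l ^+ 2 <= e * N by rewrite expr2; apply: ler_pM.
have : `|s * l| <= e / 2 * N by rewrite normrM (ger0_norm l0); apply: ler_pM.
have := ler_wpM2r N0 eh; have := sqr_ge0 l.
rewrite ler_norml => ? ? /andP[? ?]; rewrite sqrrD.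
by split; lra.
Qed.

Lemma mean_sqr_le x y : ((x + y) / 4) ^+ 2 <= x ^+ 2 + y ^+ 2.
Proof.
have := sqr_ge0 (x - y); have := sqr_ge0 x; have := sqr_ge0 y.
by rewrite expr_div_n sqrrB sqrrD; move: (x ^+ 2) (y ^+ 2) (x * y) => X Y Z; lra.
Qed.

Lemma div_sqr_lower (X Y Z S : R) : 2 < S -> 0 <= Y -> X - Y <= Z ->
  2 * X / S ^+ 2 - Y <= 2 * Z / S ^+ 2.
Proof.
move=> S2 Y0 h; have S4 : 4 <= S ^+ 2 by nra.
have S0 : 0 < S ^+ 2 by lra.
rewrite -(ler_pM2r S0) mulrBl !divfK ?gt_eqF //.
by have := ler_wpM2l Y0 S4; lra.
Qed.

Lemma scaled_lower (c X Y Z : R) : `|X - Z| <= Y -> c * Z - `|c| * Y <= c * X.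
Proof.
move=> h; rewrite lerBlDr -lerBlDl -mulrBr.
apply: le_trans (ler_norm _) _; rewrite normrM distrC.
by rewrite ler_wpM2l.
Qed.

Lemma impulse_sqr_lower (c x l g e N : R) : 0 <= c -> c <= 2 -> `|g| <= 1 -> 0 <= l -> l <= N ->
  `|x| <= 2 * e -> (c * x) ^+ 2 - 32 * e * N <= (c * x + 4 * g * l) ^+ 2.
Proof.
move=> c0 c2 hg l0 lN hx.
have : `|8 * c * x * (g * l)| <= 32 * e * N.
  rewrite !normrM (ger0_norm c0) (ger0_norm l0) (ger0_norm (ler0n R 8)).
  rewrite (_ : 32 * e * N = (8 * 2 * (2 * e)) * (1 * N)); last by ring.
  by apply: ler_pM; rewrite ?mulr_ge0 //; apply: ler_pM; rewrite ?mulr_ge0 //; lra.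
have E : c * x * (4 * g * l) *+ 2 = 8 * c * x * (g * l) by ring.
rewrite ler_norml => /andP[h _]; rewrite [leRHS]sqrrD E.
by have := sqr_ge0 (4 * g * l); lra.
Qed.

End RankOneBounds.

Section Lyapunov.
Variables (R : realType) (b : R).
Implicit Types p q l m n u v w e kap c : R.

Let a := b ^+ 2.
Let g := a * (3 - a) / (3 * a - 1).
Let S := 1 + a.
(** Lagrange multiplier of the energy with respect to the impulse: it cancels the term in [p - 4].
    In [(lam C - E) / g] a linear term in [l] survives, with coefficient [4 * e1]. *)
Let lam := (1 / 4 + g / S) / (1 + g).
Let e1 := lam - 1 / S.

(* In the lemmas below [p, q, l] are [|a|^2, |b|^2, |c|^2], [m + i n = a b^*],
   [u + i v = a c^*] and [w = Re (b c^* )]. *)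
Definition dimpulse p q l : R := (1 + g) * ((p - 4) + g * (q - 4 * a)) + 4 * g * l.

Definition denergy p q l m u w : R :=
  ln (p / 4) + g ^+ 2 * ln (q / (4 * a)) +
  g * (ln ((l + (p + q) / 4 + u - w - m / 2) / S) + ln ((l + (p + q) / 4 + u + w + m / 2) / S)
     + ln ((l + (p + q) / 4 - u - w + m / 2) / S) + ln ((l + (p + q) / 4 - u + w - m / 2) / S)).

Definition lyap kap p q l m u w : R :=
  (lam * dimpulse p q l - denergy p q l m u w) / g + kap * dimpulse p q l ^+ 2.

Hypothesis b1 : 1 < b.
Hypothesis g0 : g != 0.
Hypothesis g1 : 0 < 1 + g.

Let a1 : 1 < a. Proof. by rewrite /a exprn_egt1. Qed.
Let d0 : 3 * a - 1 != 0. Proof. by move: a1; rewrite /a => h; rewrite gt_eqF //; lra. Qed.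
Let S0 : S != 0. Proof. by move: a1; rewrite /S /a => h; rewrite gt_eqF //; lra. Qed.
Let a3 : 3 - a != 0.
Proof. by apply: contra_neq g0 => h; rewrite /g h mulr0 mul0r. Qed.
Let a0 : a != 0. Proof. by move: a1; rewrite /a => h; rewrite gt_eqF //; lra. Qed.
Let gE : 1 + g = (6 * a - 1 - a ^+ 2) / (3 * a - 1).
Proof. by rewrite /g; field. Qed.
Let a6 : 6 * a - 1 - a ^+ 2 != 0.
Proof.
by apply: contraTneq g1 => h; rewrite gE h mul0r ltxx.
Qed.

Let lam_g : lam * (1 + g) = 1 / 4 + g / S.
Proof. by rewrite /lam divfK // gt_eqF. Qed.

(* The critical point equations in the two squared diagonals agree: this is the
   equation satisfied by alpha. *)
Let lam_g' : lam * (1 + g) = g / (4 * a) + 1 / S.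
Proof.
rewrite lam_g /g /S; move: S0 d0 a0; rewrite /S; move: a => A h1 h2 h3; field.
by rewrite h1 h2 h3.
Qed.

(** The first-order terms in [p] and [q] cancel by the two equations for [lam]. The four mixed
    distances carry the orthogonal sign patterns of [d, u, w, m / 2], so the cross terms cancel when
    their squares are added; division by [g] gives these squares a positive sign. *)
Lemma lyap_taylor kap p q l m u w t1 t2 t3 t4 t5 t6 :
  let P := (p - 4) / 4 in let Q := (q - 4 * a) / (4 * a) in
  let d := l + ((p - 4) + (q - 4 * a)) / 4 in
  let r3 := (d + u - w - m / 2) / S in let r4 := (d + u + w + m / 2) / S in
  let r5 := (d - u - w + m / 2) / S in let r6 := (d - u + w - m / 2) / S in
  ln (1 + P) = P - P ^+ 2 / 2 + t1 -> ln (1 + Q) = Q - Q ^+ 2 / 2 + t2 ->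
  ln (1 + r3) = r3 - r3 ^+ 2 / 2 + t3 -> ln (1 + r4) = r4 - r4 ^+ 2 / 2 + t4 ->
  ln (1 + r5) = r5 - r5 ^+ 2 / 2 + t5 -> ln (1 + r6) = r6 - r6 ^+ 2 / 2 + t6 ->
  lyap kap p q l m u w =
   4 * e1 * l + P ^+ 2 / (2 * g) + g * Q ^+ 2 / 2
   + 2 * (d ^+ 2 + u ^+ 2 + w ^+ 2 + m ^+ 2 / 4) / S ^+ 2 + kap * dimpulse p q l ^+ 2
   - t1 / g - g * t2 - (t3 + t4 + t5 + t6).
Proof.
move=> P Q d r3 r4 r5 r6 h1 h2 h3 h4 h5 h6.
rewrite /lyap /denergy.
have -> : p / 4 = 1 + P by rewrite /P; field.
have -> : q / (4 * a) = 1 + Q by rewrite /Q; field.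
have -> : (l + (p + q) / 4 + u - w - m / 2) / S = 1 + r3.
  by rewrite /r3 /d /S; field; exact: S0.
have -> : (l + (p + q) / 4 + u + w + m / 2) / S = 1 + r4.
  by rewrite /r4 /d /S; field; exact: S0.
have -> : (l + (p + q) / 4 - u - w + m / 2) / S = 1 + r5.
  by rewrite /r5 /d /S; field; exact: S0.
have -> : (l + (p + q) / 4 - u + w - m / 2) / S = 1 + r6.
  by rewrite /r6 /d /S; field; exact: S0.
rewrite h1 h2 h3 h4 h5 h6 {h1 h2 h3 h4 h5 h6}.
have CE : lam * dimpulse p q l = (1 / 4 + g / S) * (p - 4)
    + g * (g / (4 * a) + 1 / S) * (q - 4 * a) + 4 * g * lam * l.
  by rewrite -{1}lam_g -lam_g' /dimpulse; move: lam a g => L A G; ring.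
rewrite CE /e1 /P /Q /r3 /r4 /r5 /r6 /d; move: lam (dimpulse p q l) S0 g0 a0.
by move: a g S => A G T L D T0 G0 A0; field; rewrite T0 G0.
Qed.

Let S2 : 2 < S. Proof. by move: a1; rewrite /S; lra. Qed.

(** Every error is at most a constant times [e * N]: the Taylor remainders, the replacement of
    [4 * l] by [u^2 + v^2] and of [w^2] by [a v^2], and the part of [d] and of the impulse that
    comes from [l]. [K] dominates the sum of these constants; [k] is the one in
    [w^2 <= k (u^2 + v^2)]. *)
Lemma lyap_ge kap p q l m n u v w e (k K N : R) : 0 <= kap -> g < 1 ->
  e <= 1 / 8 -> `|p - 4| <= e -> `|q - 4 * a| <= e -> `|l| <= e -> `|m| <= e ->
  `|n + 4 * b| <= e -> `|u| <= e -> `|w| <= e ->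
  p * l = u ^+ 2 + v ^+ 2 -> p * w = m * u + n * v ->
  k = 1 + (4 * b + 1) ^+ 2 ->
  K = 2 * `|g^-1| + 2 + 16 * (6 + k) + `|e1| + 2 + (b + 1 + k) + 32 * kap ->
  N = (p - 4) ^+ 2 + (q - 4 * a) ^+ 2 + m ^+ 2 + u ^+ 2 + v ^+ 2 ->
  e1 * (u ^+ 2 + v ^+ 2) + ((p - 4) / 4) ^+ 2 / (2 * g) + g * ((q - 4 * a) / (4 * a)) ^+ 2 / 2
  + 2 * (((p - 4 + (q - 4 * a)) / 4) ^+ 2 + u ^+ 2 + a * v ^+ 2 + m ^+ 2 / 4) / S ^+ 2
  + kap * ((1 + g) * ((p - 4) + g * (q - 4 * a))) ^+ 2 - K * e * N <= lyap kap p q l m u w.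
Proof.
move=> kap0 gl1 e8 hp hq hl hm hn hu hw E1 E2 hk hK hN.
have e0 : 0 <= e by apply: le_trans hm.
have eh : e <= 1 by lra.
have [l0 l1 l2] := rank1_l_bounds hp eh hl E1.
have p3 : 3 <= p by move: hp; rewrite ler_norml => /andP[]; lra.
have m1 : `|m| <= 1 by lra.
have n1 : `|n| <= 4 * b + 1 by move: b1 hn => bb; rewrite !ler_norml => /andP[? ?]; apply/andP; split; lra.
have wk : w ^+ 2 <= k * (u ^+ 2 + v ^+ 2)
  by rewrite hk; exact: rank1_w_le p3 m1 n1 E2.
have k0 : 0 <= k by rewrite hk addr_ge0 ?sqr_ge0.
have wg := rank1_w_ge hp eh hm (ltW b1) hn E2 k0 wk.
have uvN : u ^+ 2 + v ^+ 2 <= N by rewrite hN -addrA lerDr !addr_ge0 ?sqr_ge0.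
have N0 : 0 <= N by apply: le_trans uvN; rewrite addr_ge0 ?sqr_ge0.
have [pN qN] : (p - 4) ^+ 2 <= N /\ (q - 4 * a) ^+ 2 <= N.
  split; rewrite hN -!addrA; first by rewrite lerDl !addr_ge0 ?sqr_ge0.
  by rewrite addrCA lerDl !addr_ge0 ?sqr_ge0.
have [uN mN] : u ^+ 2 <= N /\ m ^+ 2 <= N.
  split; first by apply: le_trans uvN; rewrite lerDl sqr_ge0.
  by rewrite hN addrAC [_ + m ^+ 2]addrC -!addrA lerDl !addr_ge0 ?sqr_ge0.
pose s := ((p - 4) + (q - 4 * a)) / 4; pose d := l + s.
have hs : `|s| <= e / 2.
  rewrite /s; move: hp hq; move: (p - 4) (q - 4 * a) => x y; clear -b1 g0 g1 a1 d0 S0 a3 a0 gE a6 lam_g lam_g' S2.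
  by rewrite !ler_norml => /andP[? ?] /andP[? ?]; apply/andP; split; lra.
have s2 : s ^+ 2 <= N.
  by apply: le_trans (mean_sqr_le _ _) _; rewrite hN -!addrA lerD2l lerDl !addr_ge0 ?sqr_ge0.
have le_l : l <= e by apply: le_trans hl; exact: ler_norm.
have lN : l <= N by exact: le_trans uvN.
have [d_ge d_le] := sqrD_bounds l0 le_l lN N0 eh hs s2.
have dm : `|d| <= 3 / 2 * e.
  rewrite /d; move: hl hs; move: (s) => x; clear -b1 g0 g1 a1 d0 S0 a3 a0 gE a6 lam_g lam_g' S2.
  by rewrite !ler_norml => /andP[? ?] /andP[? ?]; apply/andP; split; lra.
have [D3 D4 D5 D6] := norm_combinations dm hu hw hm.
have e2 : 2 * e <= 1 / 2 by move: e8; clear -b1 g0 g1 a1 d0 S0 a3 a0 gE a6 lam_g lam_g' S2; lra.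
have eh2 : e <= 1 / 2 by move: e8; clear -b1 g0 g1 a1 d0 S0 a3 a0 gE a6 lam_g lam_g' S2; lra.
have l14 : 1 <= 4 :> R by clear -b1 g0 g1 a1 d0 S0 a3 a0 gE a6 lam_g lam_g' S2; lra.
have l14a : 1 <= 4 * a by move: a1; clear -b1 g0 g1 a1 d0 S0 a3 a0 gE a6 lam_g lam_g' S2; lra.
have [t1 T1 H1] := ln1D_bound (norm_div_le l14 hp) eh2.
have [t2 T2 H2] := ln1D_bound (norm_div_le l14a hq) eh2.
have [t3 T3 H3] := ln1D_bound (norm_div_le2 S2 D3) e2.
have [t4 T4 H4] := ln1D_bound (norm_div_le2 S2 D4) e2.
have [t5 T5 H5] := ln1D_bound (norm_div_le2 S2 D5) e2.
have [t6 T6 H6] := ln1D_bound (norm_div_le2 S2 D6) e2.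
rewrite (lyap_taylor kap H1 H2 H3 H4 H5 H6) -/s -/d.
have ee0 : 0 <= 2 * e by move: e0; clear -b1 g0 g1 a1 d0 S0 a3 a0 gE a6 lam_g lam_g' S2; lra.
have B1 : t1 / g <= `|g^-1| * (2 * e * N).
  apply: le_trans (ler_norm _) _; rewrite normrM mulrC ler_wpM2l //.
  apply: le_trans T1 _; rewrite ler_wpM2l //.
  exact: le_trans (sqr_div_le _ l14) pN.
have hg : `|g| <= 1.
  by rewrite ler_norml; move: g1 gl1; clear -b1 g0 g1 a1 d0 S0 a3 a0 gE a6 lam_g lam_g' S2 => ? ?; apply/andP; split; lra.
have B2 : g * t2 <= 2 * e * N.
  apply: le_trans (ler_norm _) _; rewrite normrM -[leRHS]mul1r; apply: ler_pM => //.
  apply: le_trans T2 _; rewrite ler_wpM2l //.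
  exact: le_trans (sqr_div_le _ l14a) qN.
have B3 : t3 + t4 + t5 + t6 <= 16 * (6 + k) * e * N.
  have wN : w ^+ 2 <= k * N by apply: le_trans wk _; rewrite ler_wpM2l.
  have l1S : 1 <= S by move: S2; clear -b1 g0 g1 a1 d0 S0 a3 a0 gE a6 lam_g lam_g' S2; lra.
  have h x t : `|t| <= 2 * (2 * e) * (x / S) ^+ 2 -> t <= 4 * e * x ^+ 2.
    move=> ht; apply: le_trans (ler_norm _) _; apply: le_trans ht _.
    rewrite (_ : 4 * e = 2 * (2 * e)); last by ring.
    by rewrite ler_wpM2l ?sqr_div_le // mulr_ge0.
  move: (h _ _ T3) (h _ _ T4) (h _ _ T5) (h _ _ T6) => h3 h4 h5 h6.
  have E4 : (d + u - w - m / 2) ^+ 2 + (d + u + w + m / 2) ^+ 2 + (d - u - w + m / 2) ^+ 2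
     + (d - u + w - m / 2) ^+ 2 = 4 * d ^+ 2 + 4 * u ^+ 2 + 4 * w ^+ 2 + m ^+ 2.
    by move: (d); clear -b1 g0 g1 a1 d0 S0 a3 a0 gE a6 lam_g lam_g' S2 => ?; field.
  have h7 : (d + u - w - m / 2) ^+ 2 + (d + u + w + m / 2) ^+ 2 + (d - u - w + m / 2) ^+ 2
     + (d - u + w - m / 2) ^+ 2 <= 4 * ((6 + k) * N).
    rewrite E4; move: d_le uN wN mN N0; move: (d ^+ 2) (u ^+ 2) (w ^+ 2) (m ^+ 2); clear -b1 g0 g1 a1 d0 S0 a3 a0 gE a6 lam_g lam_g' S2.
    by move=> D U W M *; rewrite mulrDl; lra.
  apply: (le_trans (lerD (lerD (lerD h3 h4) h5) h6)); rewrite -!mulrDr.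
  have e40 : 0 <= 4 * e by move: e0; clear -b1 g0 g1 a1 d0 S0 a3 a0 gE a6 lam_g lam_g' S2; lra.
  by apply: (le_trans (ler_wpM2l e40 h7)); rewrite le_eqVlt; apply/orP; left; apply/eqP; ring.
have F1 : e1 * (u ^+ 2 + v ^+ 2) - `|e1| * (e * N) <= e1 * (4 * l).
  apply: le_trans (scaled_lower _ l2); rewrite lerD2l lerN2 ler_wpM2l // ler_wpM2l //.
have F2 : 2 * s ^+ 2 / S ^+ 2 - e * N <= 2 * d ^+ 2 / S ^+ 2.
  by apply: div_sqr_lower => //; rewrite mulr_ge0.
have F3 : 2 * (a * v ^+ 2) / S ^+ 2 - e * (b + 1 + k) * N <= 2 * w ^+ 2 / S ^+ 2.
  have c0 : 0 <= e * (b + 1 + k) by rewrite mulr_ge0 //; move: b1 k0; clear -b1 g0 g1 a1 d0 S0 a3 a0 gE a6 lam_g lam_g' S2; lra.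
  apply: div_sqr_lower => //; first by rewrite mulr_ge0.
  by apply: le_trans wg; rewrite lerD2l lerN2 ler_wpM2l.
have F4 : kap * ((1 + g) * ((p - 4) + g * (q - 4 * a))) ^+ 2 - kap * (32 * e * N) <= kap * dimpulse p q l ^+ 2.
  rewrite -mulrBr ler_wpM2l // /dimpulse; apply: impulse_sqr_lower => //; first exact: ltW.
    by move: gl1; clear -b1 g0 g1 a1 d0 S0 a3 a0 gE a6 lam_g lam_g' S2; lra.
  apply: le_trans (ler_normD _ _) _; rewrite normrM.
  have : `|g| * `|q - 4 * a| <= 1 * e by apply: ler_pM.
  by move: hp; clear -b1 g0 g1 a1 d0 S0 a3 a0 gE a6 lam_g lam_g' S2; lra.
have eN0 : 0 <= e * N by exact: mulr_ge0.
rewrite hK; move: eN0 B1 B2 B3 F1 F2 F3 F4; clear -b1 g0 g1 a1 d0 S0 a3 a0 gE a6 lam_g lam_g' S2.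
have -> : 2 * (s ^+ 2 + u ^+ 2 + a * v ^+ 2 + m ^+ 2 / 4) / S ^+ 2 =
  2 * s ^+ 2 / S ^+ 2 + 2 * (a * v ^+ 2) / S ^+ 2 + 2 * (u ^+ 2 + m ^+ 2 / 4) / S ^+ 2.
  by rewrite -!mulrDl -!mulrDr; congr (_ * _ / _); ring.
have -> : 2 * (d ^+ 2 + u ^+ 2 + w ^+ 2 + m ^+ 2 / 4) / S ^+ 2 =
  2 * d ^+ 2 / S ^+ 2 + 2 * w ^+ 2 / S ^+ 2 + 2 * (u ^+ 2 + m ^+ 2 / 4) / S ^+ 2.
  by rewrite -!mulrDl -!mulrDr; congr (_ * _ / _); ring.
have -> : (2 * `|g^-1| + 2 + 16 * (6 + k) + `|e1| + 2 + (b + 1 + k) + 32 * kap) * e * N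
  = `|g^-1| * (2 * e * N) + 2 * e * N + 16 * (6 + k) * e * N + `|e1| * (e * N)
   + 2 * (e * N) + e * (b + 1 + k) * N + kap * (32 * e * N).
  by move: `|g^-1| `|e1| => ? ?; ring.
have -> : 4 * e1 * l = e1 * (4 * l) by move: (e1) => ?; ring.
move: (t1 / g) (g * t2) (2 * s ^+ 2 / S ^+ 2) (2 * (a * v ^+ 2) / S ^+ 2) (2 * d ^+ 2 / S ^+ 2)
  (2 * w ^+ 2 / S ^+ 2) (kap * ((1 + g) * (p - 4 + g * (q - 4 * a))) ^+ 2)
  (kap * dimpulse p q l ^+ 2) (((p - 4) / 4) ^+ 2 / (2 * g))
  (g * ((q - 4 * a) / (4 * a)) ^+ 2 / 2) (2 * (u ^+ 2 + m ^+ 2 / 4) / S ^+ 2)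
  (`|g^-1| * (2 * e * N)) (16 * (6 + k) * e * N) (e1 * (u ^+ 2 + v ^+ 2)) (`|e1| * (e * N))
  (e1 * (4 * l)) (e * (b + 1 + k) * N) (kap * (32 * e * N)).
move=> ? ? ? ? ? ? ? ? ? ? ? ? ? ? ? ? ? ? eN0 B1 B2 B3 F1 F2 F3 F4; lra.
Qed.

Let d1 : 0 < 3 * a - 1. Proof. by have := a1; lra. Qed.
Let a61 : 0 < 6 * a - 1 - a ^+ 2.
Proof. by have := g1; rewrite gE pmulr_lgt0 // invr_gt0. Qed.

(** This is the coefficient of [u^2]. As [e1 = (a - 3) / (4 S (1 + g))] is negative for [g > 0], its
    sign is not evident. As a function of [a] the numerator is a cubic positive for [a > 1], and the
    denominator is positive because [1 + g > 0]. *)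
Let cu_gt0 : 0 < e1 + 2 / S ^+ 2.
Proof.
have -> : e1 + 2 / S ^+ 2 = (3 * a ^+ 3 - 15 * a ^+ 2 + 41 * a - 5) / (4 * S ^+ 2 * (6 * a - 1 - a ^+ 2)).
  rewrite /e1 /lam gE /g; move: S0 d0 a6; rewrite /S; move: a => A h1 h2 h3; field.
  by rewrite h1 h2 h3.
have := S2; have := a61; have := a1; move: a S => A T A1 A6 T2.
apply: divr_gt0; last by rewrite mulr_gt0 // mulr_gt0 // exprn_gt0 //; lra.
have -> : 3 * A ^+ 3 - 15 * A ^+ 2 + 41 * A - 5 =
  A * (3 * (A - 5 / 2) ^+ 2) + 89 / 4 * A - 5 by field.
have : 0 <= A * (3 * (A - 5 / 2) ^+ 2) by apply: mulr_ge0; [lra|apply: mulr_ge0; rewrite ?sqr_ge0].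
lra.
Qed.

Let cv_gt0 : 0 < e1 + 2 * a / S ^+ 2.
Proof.
apply: lt_le_trans cu_gt0 _; rewrite lerD2l ler_wpM2r ?invr_ge0 ?sqr_ge0 //.
by have := a1; lra.
Qed.

(** This is the coefficient of [(q - 4 a)^2] on the kernel [p - 4 = - g (q - 4 a)] of the linearized
    impulse. Its sign is that of [- (a^2 - 4 a + 1)], which is how the threshold enters
    stability. *)
Let kpq_gt0 : a ^+ 2 - 4 * a + 1 < 0 ->
  0 < (g * (1 + 1 / a ^+ 2) + 4 * (1 - g) ^+ 2 / S ^+ 2) / 32.
Proof.
move=> h; have -> : (g * (1 + 1 / a ^+ 2) + 4 * (1 - g) ^+ 2 / S ^+ 2) / 32 =
  (3 * (a - 1 / 3) ^+ 2 + 8 / 3) * - (a ^+ 2 - 4 * a + 1) / (32 * a * (3 * a - 1) ^+ 2).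
  rewrite /g; move: S0 d0 a0; rewrite /S; move: a => A h1 h2 h3; field.
  by rewrite h1 h2 h3.
have := d1; have := a1; move: a h => A h A1 D1.
apply: divr_gt0; last by rewrite mulr_gt0 ?mulr_gt0 ?exprn_gt0 //; lra.
apply: mulr_gt0; last by rewrite oppr_gt0.
by have := sqr_ge0 (A - 1 / 3); lra.
Qed.

Lemma lyap_pos : g < 1 -> a ^+ 2 - 4 * a + 1 < 0 ->
  exists kap c e, [/\ 0 < c, 0 < e, e <= 1 / 8 & forall p q l m n u v w,
    `|p - 4| <= e -> `|q - 4 * a| <= e -> `|l| <= e -> `|m| <= e ->
    `|n + 4 * b| <= e -> `|u| <= e -> `|w| <= e ->
    p * l = u ^+ 2 + v ^+ 2 -> p * w = m * u + n * v ->
    c * ((p - 4) ^+ 2 + (q - 4 * a) ^+ 2 + m ^+ 2 + u ^+ 2 + v ^+ 2) <= lyap kap p q l m u w].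
Proof.
move=> gl1 hth.
(* Coefficients of the form in the two squared diagonals after the change of variables to
   [z = x + g y] and [y], with [x = p - 4] and [y = q - 4 a]; the impulse is [(1 + g) z] to first
   order. *)
pose A := 1 / (32 * g) + 1 / (8 * S ^+ 2).
pose B := 1 / (8 * S ^+ 2) - g * A.
have [c1 [kap1 [c10 kap10 Hq]]] := quad_penalty A B (kpq_gt0 hth).
pose kap := kap1 / (1 + g) ^+ 2.
have kap0 : 0 <= kap by rewrite divr_ge0 // sqr_ge0.
pose cm := 1 / (2 * S ^+ 2).
have cm0 : 0 < cm by rewrite divr_gt0 // mulr_gt0 // exprn_gt0 //; have := S2; lra.
pose cu := e1 + 2 / S ^+ 2; pose cv := e1 + 2 * a / S ^+ 2.
pose c := Num.min (Num.min cu cv) (Num.min cm (c1 / 3)).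
have c0 : 0 < c by rewrite !lt_min cu_gt0 cv_gt0 cm0 divr_gt0.
have [[lcu lcv] [lcm lc1]] : (c <= cu /\ c <= cv) /\ (c <= cm /\ c <= c1 / 3).
  by do !split; rewrite !ge_min lexx ?orbT.
pose k := 1 + (4 * b + 1) ^+ 2.
pose K := 2 * `|g^-1| + 2 + 16 * (6 + k) + `|e1| + 2 + (b + 1 + k) + 32 * kap.
have K0 : 0 < K.
  have := normr_ge0 g^-1; have := normr_ge0 e1; have := sqr_ge0 (4 * b + 1); have := b1; have := kap0.
  rewrite /K /k; move: `|g^-1| `|e1| (kap) ((4 * b + 1) ^+ 2) => ? ? ? ? ? ? ? ? ?; lra.
(* With this radius the errors [K * e * N] consume at most half of the definiteness [c * N]. *)
pose e := Num.min (1 / 8) (c / (2 * K)).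
have e0 : 0 < e by rewrite lt_min !divr_gt0 ?mulr_gt0.
have e8 : e <= 1 / 8 by rewrite ge_min lexx.
have eK : K * e <= c / 2.
  have : e <= c / (2 * K) by rewrite ge_min lexx orbT.
  by rewrite ler_pdivlMr ?mulr_gt0 //; lra.
exists kap, (c / 2), e; split=> //; first by rewrite divr_gt0.
move=> p q l m n u v w hp hq hl hm hn hu hw E1 E2.
set N := _ + v ^+ 2.
have := lyap_ge kap0 gl1 e8 hp hq hl hm hn hu hw E1 E2 erefl erefl erefl.
rewrite -/k -/K -/N; apply: le_trans.
have N0 : 0 <= N by rewrite /N !addr_ge0 ?sqr_ge0.
rewrite lerBrDr; apply: le_trans (_ : c * N <= _).
  by have := ler_wpM2r N0 eK; move: (K * e) (N) => ? ? ; lra.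
set x := p - 4; set y := q - 4 * a.
have -> : kap * ((1 + g) * (x + g * y)) ^+ 2 = kap1 * (x + g * y) ^+ 2.
  have g10 : 1 + g != 0 by rewrite gt_eqF.
  by rewrite exprMn mulrA /kap divfK // expf_neq0.
have EQ : e1 * (u ^+ 2 + v ^+ 2) + (x / 4) ^+ 2 / (2 * g) + g * (y / (4 * a)) ^+ 2 / 2 +
  2 * (((x + y) / 4) ^+ 2 + u ^+ 2 + a * v ^+ 2 + m ^+ 2 / 4) / S ^+ 2 + kap1 * (x + g * y) ^+ 2
  = cu * u ^+ 2 + cv * v ^+ 2 + cm * m ^+ 2 +
   (A * (x + g * y) ^+ 2 + 2 * B * (x + g * y) * y
    + (g * (1 + 1 / a ^+ 2) + 4 * (1 - g) ^+ 2 / S ^+ 2) / 32 * y ^+ 2 + kap1 * (x + g * y) ^+ 2).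
  rewrite /cu /cv /cm /B /A; move: e1 x y S0 g0 a0; move: S g a => T G Aa E x y T0 G0 A0; field.
  by rewrite T0 G0 A0.
rewrite EQ; apply: le_trans (_ : _ <= cu * u ^+ 2 + cv * v ^+ 2 + cm * m ^+ 2 + c1 * ((x + g * y) ^+ 2 + y ^+ 2)) _; last by rewrite lerD2l.
(* Going back from [z, y] to [x, y] costs a factor 3 because [|g| <= 1], whence [c1 / 3] in [c]. *)
have hxy : x ^+ 2 + y ^+ 2 <= 3 * ((x + g * y) ^+ 2 + y ^+ 2).
  have -> : x = (x + g * y) - g * y by rewrite addrK.
  move: (x + g * y) => z; have := sqr_ge0 (z + g * y).
  have : (g * y) ^+ 2 <= y ^+ 2.
    rewrite exprMn ler_piMl ?sqr_ge0 // -[g ^+ 2]real_normK ?num_real // exprn_ile1 //.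
    by rewrite ler_norml; have := g1; move: gl1 => ? ?; apply/andP; split; lra.
  have := sqr_ge0 z; have := sqr_ge0 y; move: (g * y) => t; rewrite sqrrB sqrrD; lra.
have U : c * (x ^+ 2 + y ^+ 2) <= c1 * ((x + g * y) ^+ 2 + y ^+ 2).
  apply: le_trans (ler_wpM2l (ltW c0) hxy) _.
  have z0 : 0 <= (x + g * y) ^+ 2 + y ^+ 2 by rewrite addr_ge0 ?sqr_ge0.
  by have := ler_wpM2r z0 lc1; move: (_ + y ^+ 2) => z; lra.
have V1 := ler_wpM2r (sqr_ge0 u) lcu.
have V2 := ler_wpM2r (sqr_ge0 v) lcv.
have V3 := ler_wpM2r (sqr_ge0 m) lcm.
have -> : c * N = c * (x ^+ 2 + y ^+ 2) + c * m ^+ 2 + c * u ^+ 2 + c * v ^+ 2.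
  by rewrite /N -/x -/y; move: (c) (x) (y) => *; ring.
move: U V1 V2 V3; move: (c1 * _) (c * (x ^+ 2 + y ^+ 2)) (c * m ^+ 2) (c * u ^+ 2) (c * v ^+ 2)
  (cu * u ^+ 2) (cv * v ^+ 2) (cm * m ^+ 2) => *; lra.
Qed.

End Lyapunov.

(** * Conservation laws and invariance of rank one *)

Section RealFunctions.
Variable R : realType.
Implicit Types (f : R -> R) (s t T c : R).

Lemma within_sub (V : topologicalType) (f : R -> V) s t (T : R) : 0 <= s -> t < T ->
  {within `[0, T[, continuous f} -> {within `[s, t], continuous f}.
Proof.
move=> s0 tT; apply: continuous_subspaceW => x /=.
by rewrite !in_itv /= => /andP[sx xt]; rewrite (le_trans s0 sx) (le_lt_trans xt tT).
Qed.

Lemma const_of_derive0 f t : 0 <= t -> {within `[0, t], continuous f} ->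
  (forall s, 0 < s < t -> is_derive s 1 f 0) -> f t = f 0.
Proof.
move=> t0 cf df.
have D s : s \in `]0, t[%R -> is_derive s 1 f ((fun=> 0) s) by rewrite in_itv; exact: df.
have [s _] := MVT_segment t0 D cf.
by rewrite mul0r => /eqP; rewrite subr_eq0 => /eqP.
Qed.

(* Gronwall: [f * exp (- c t)] is nonincreasing. *)
Lemma gronwall0 f (df : R -> R) c t : 0 <= t -> {within `[0, t], continuous f} ->
  (forall s, 0 < s < t -> is_derive s 1 f (df s)) ->
  (forall s, 0 < s < t -> df s <= c * f s) ->
  f 0 = 0 -> f t <= 0.
Proof.
move=> t0 cf hdf hle f0.
pose h s := f s * expR (- (c * s)).
have dE (s : R) : is_derive s 1 (fun s : R => expR (- (c * s))) (- c * expR (- (c * s))).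
  have D : is_derive s 1 (fun s : R => - (c * s)) (- c).
    apply: is_derive_eq (is_derive_fopp (is_derive_fmul (is_derive_fcst c s 1) (is_derive_id s 1))) _.
    by rewrite mulr0 addr0 mulr1.
  have := is_derive1_comp (f := expR) (is_derive_expR _) D.
  by rewrite mulrC.
have D s : s \in `]0, t[%R -> is_derive s 1 h ((df s - c * f s) * expR (- (c * s))).
  rewrite in_itv => hs; apply: is_derive_eq (is_derive_fmul (hdf s hs) (dE s)) _.
  by move: (expR _) => e; ring.
have ch : {within `[0, t], continuous h}.
  move=> x; apply: cvgM; first exact: cf.
  by apply: continuous_subspaceT => y; apply: differentiable_continuous;
    apply/derivable1_diffP; exact: ex_derive.
move: t0; rewrite le_eqVlt => /predU1P[<-|t0]; first by rewrite f0.
have [s] := MVT t0 D ch.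
rewrite in_itv /= => hs; rewrite {2}/h f0 mul0r !subr0 => ht.
have : h t <= 0.
  rewrite ht mulr_le0_ge0 ?(ltW t0) // mulr_le0_ge0 ?expR_ge0 //.
  by rewrite subr_le0; exact: hle.
by rewrite /h pmulr_lle0 // expR_gt0.
Qed.

(** The exit time is the infimum of the times at which [f] is at least [eta]; continuity excludes
    both a larger and a smaller value there. *)
Lemma first_exit f t eta : 0 <= t -> {within `[0, t], continuous f} ->
  f 0 < eta -> eta <= f t -> exists2 s, 0 <= s <= t &
    f s = eta /\ forall r, 0 <= r < s -> f r < eta.
Proof.
move=> t0 cf f0 ft.
pose B := [set s | 0 <= s <= t /\ eta <= f s].
have B0 : B !=set0 by exists t; rewrite /B /= t0 lexx.
have hB : has_inf B by split=> //; exists 0 => s [/andP[]].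
have lB r : B r -> inf B <= r by move=> Br; apply: ge_inf => //; case: hB.
have s0 : 0 <= inf B by apply: lb_le_inf => // s [/andP[]].
have st : inf B <= t by apply: lB; rewrite /B /= t0 lexx.
have hlt r : 0 <= r < inf B -> f r < eta.
  move=> /andP[r0 rs]; rewrite ltNge; apply/negP => h.
  by have := lB r; rewrite leNgt rs /B /= r0 (le_trans (ltW rs) st) => /(_ (conj isT h)).
have /subspace_continuousP/(_ (inf B)) := cf.
rewrite /= in_itv /= s0 st => /(_ isT) cs.
have near_s (P : set R) : (\forall y \near f (inf B), P y) ->
    exists2 d, 0 < d & forall r, 0 <= r <= t -> `|inf B - r| < d -> P (f r).
  move=> /cs; rewrite /= /within /= => /nbhs_ballP [d d0 hd]; exists d => // r hr rd.
  by apply: hd => //=; rewrite in_itv.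
exists (inf B); first by rewrite s0.
split=> //; apply/eqP; rewrite eq_le; apply/andP; split; rewrite leNgt; apply/negP => h.
  have [d d0 hd] := near_s [set y | eta < y] (lt_nbhsr h).
  have sp : 0 < inf B.
    by rewrite lt_neqAle s0 andbT; apply: contraTneq h => <-; rewrite -leNgt ltW.
  (* A time just before the infimum at which [f] would already exceed [eta]. *)
  pose r := Num.max 0 (inf B - d / 2).
  have r0 : 0 <= r by rewrite le_max lexx.
  have rs : r < inf B by rewrite gt_max sp; lra.
  have rd : inf B - d / 2 <= r by rewrite le_max lexx orbT.
  have := hlt r; rewrite r0 rs => /(_ isT) => h1.
  have : eta < f r.
    apply: hd; first by rewrite r0 (le_trans (ltW rs) st).
    by rewrite ger0_norm ?subr_ge0 ?(ltW rs) //; lra.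
  by rewrite ltNge (ltW h1).
have [d d0 hd] := near_s [set y | y < eta] (lt_nbhsl h).
have [r [hr fr] rd] := inf_adherent d0 hB.
have Br : B r by [].
have : f r < eta.
  by apply: hd => //; rewrite distrC ger0_norm ?subr_ge0 ?lB //; lra.
by rewrite ltNge fr.
Qed.

End RealFunctions.

Section Flow.
Variables (R : realType) (g : R).
Implicit Types x : 'rV[R]_9.

Definition transposed (M : nat -> nat -> R) i j := M j i.

(** The adjugate of a Hermitian matrix is Hermitian, so it is listed in the same nine real
    coordinates as the matrix. Entries 0, 2, 5 and 6 are the components of [Fmap]. *)
Definition adjseq x : seq R :=
  [:: x.[: 1] * x.[: 2] - x.[: 7] ^+ 2 - x.[: 8] ^+ 2;
      x.[: 0] * x.[: 2] - x.[: 5] ^+ 2 - x.[: 6] ^+ 2;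
      x.[: 0] * x.[: 1] - x.[: 3] ^+ 2 - x.[: 4] ^+ 2;
      x.[: 5] * x.[: 7] + x.[: 6] * x.[: 8] - x.[: 3] * x.[: 2];
      x.[: 6] * x.[: 7] - x.[: 5] * x.[: 8] - x.[: 4] * x.[: 2];
      x.[: 3] * x.[: 7] - x.[: 4] * x.[: 8] - x.[: 5] * x.[: 1];
      x.[: 3] * x.[: 8] + x.[: 4] * x.[: 7] - x.[: 6] * x.[: 1];
      x.[: 5] * x.[: 3] + x.[: 6] * x.[: 4] - x.[: 0] * x.[: 7];
      x.[: 6] * x.[: 3] - x.[: 5] * x.[: 4] - x.[: 0] * x.[: 8]].

Definition adjcoord x : 'rV[R]_9 := \row_k nth 0 (adjseq x) k.

Definition relMx x : nat -> nat -> R :=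
  relM g x.[: 0]^-1 x.[: 1]^-1 x.[: 2]^-1 (x.[: 0] + x.[: 1] - 2 * x.[: 3])^-1
    (x.[: 0] + x.[: 2] - 2 * x.[: 5])^-1 (x.[: 1] + x.[: 2] - 2 * x.[: 7])^-1.

Lemma rateE x : rate g x = rateM (relMx x) x. Proof. by []. Qed.

(* [adj(A)' = i (M^T adj(A) - adj(A) M)] when [A' = i (M A - A M^T)]: the
   adjugate follows the same law with [M] transposed. *)
Lemma is_derive_adjcoord (u : R -> 'rV[R]_9) (t c : R) (M : nat -> nat -> R) k :
  (k < 9)%N ->
  (forall k, (k < 9)%N -> is_derive t 1 (fun s => (u s).[: k]) (c * nth 0 (rateM M (u t)) k)) ->
  is_derive t 1 (fun s => (adjcoord (u s)).[: k])
    (c * nth 0 (rateM (transposed M) (adjcoord (u t))) k).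
Proof.
move=> k9 hu.
have -> : (fun s => (adjcoord (u s)).[: k]) = (fun s => nth 0 (adjseq (u s)) k).
  by apply/funext => s; rewrite row9E.
suff [d [dk <-]] : exists d, has_deriv (fun s => nth 0 (adjseq (u s)) k) t 1 d /\
    d = c * nth 0 (rateM (transposed M) (adjcoord (u t))) k by [].
rewrite /adjseq.
have X : forall k, (k < 9)%N -> has_deriv (fun s => (u s).[: k]) t 1 (c * nth 0 (rateM M (u t)) k) := hu.
have A := @has_derivD R R.
have N := @has_derivN R R.
have P := @has_derivM R R.
have Q (f : R -> R) (x v df : R) : has_deriv f x v df -> has_deriv (fun y => f y ^+ 2) x v (2 * f x * df).
  exact: is_derive_fsqr.
case: k k9 => [|[|[|[|[|[|[|[|[|//]]]]]]]]] _ /=; eexists; (split; [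
  do ?[by apply: X|apply: (Q)|apply: (P)|apply: (N)|apply: (A)]|]).
all: rewrite /rateM /adjcoord !row9E //= /adjseq /transposed /=.
all: move: (u t) (M 0%N 0%N) (M 0%N 1%N) (M 0%N 2%N) (M 1%N 0%N) (M 1%N 1%N) (M 1%N 2%N) (M 2%N 0%N) (M 2%N 1%N) (M 2%N 2%N).
all: move=> x m00 m01 m02 m10 m11 m12 m20 m21 m22; clear; gen9 x; ring.
Qed.

(** Each coordinate is a combination of products of an entry of [M] and a coordinate of [x] whose
    coefficients add up to at most 6 in absolute value. *)
Lemma rateM_bound (M : nat -> nat -> R) x (c r : R) k : 0 <= r ->
  (forall i j, (i < 3)%N -> (j < 3)%N -> `|M i j| <= c) ->
  (forall l, (l < 9)%N -> `|x.[: l]| <= r) -> (k < 9)%N ->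
  `|nth 0 (rateM M x) k| <= 6 * c * r.
Proof.
move=> r0 hM hx k9.
have h i j l : (i < 3)%N -> (j < 3)%N -> (l < 9)%N ->
    - (c * r) <= M i j * x.[: l] /\ M i j * x.[: l] <= c * r.
  move=> i3 j3 l9; apply/andP; rewrite -ler_norml normrM.
  by apply: ler_pM => //; [exact: hM|exact: hx].
have cr : 0 <= c * r by rewrite mulr_ge0 // (le_trans _ (hM 0%N 0%N isT isT)).
rewrite -[6 * c * r]mulrA ler_norml; move: (c * r) cr h => C cr h.
case: k k9 => [|[|[|[|[|[|[|[|[|//]]]]]]]]] _ /=; apply/andP.
- by have [? ?] := h 0%N 1%N 4%N isT isT isT; have [? ?] := h 0%N 2%N 6%N isT isT isT; split; lra.
- by have [? ?] := h 1%N 2%N 8%N isT isT isT; have [? ?] := h 1%N 0%N 4%N isT isT isT; split; lra.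
- by have [? ?] := h 2%N 0%N 6%N isT isT isT; have [? ?] := h 2%N 1%N 8%N isT isT isT; split; lra.
- by have [? ?] := h 0%N 2%N 8%N isT isT isT; have [? ?] := h 1%N 1%N 4%N isT isT isT; have [? ?] := h 1%N 2%N 6%N isT isT isT; have [? ?] := h 0%N 0%N 4%N isT isT isT; split; lra.
- by have [? ?] := h 0%N 0%N 3%N isT isT isT; have [? ?] := h 0%N 1%N 1%N isT isT isT; have [? ?] := h 0%N 2%N 7%N isT isT isT; have [? ?] := h 1%N 0%N 0%N isT isT isT; have [? ?] := h 1%N 1%N 3%N isT isT isT; have [? ?] := h 1%N 2%N 5%N isT isT isT; split; lra.
- by have [? ?] := h 2%N 1%N 4%N isT isT isT; have [? ?] := h 2%N 2%N 6%N isT isT isT; have [? ?] := h 0%N 0%N 6%N isT isT isT; have [? ?] := h 0%N 1%N 8%N isT isT isT; split; lra.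
- by have [? ?] := h 0%N 0%N 5%N isT isT isT; have [? ?] := h 0%N 1%N 7%N isT isT isT; have [? ?] := h 0%N 2%N 2%N isT isT isT; have [? ?] := h 2%N 0%N 0%N isT isT isT; have [? ?] := h 2%N 1%N 3%N isT isT isT; have [? ?] := h 2%N 2%N 5%N isT isT isT; split; lra.
- by have [? ?] := h 2%N 2%N 8%N isT isT isT; have [? ?] := h 1%N 0%N 6%N isT isT isT; have [? ?] := h 1%N 1%N 8%N isT isT isT; have [? ?] := h 2%N 0%N 4%N isT isT isT; split; lra.
- by have [? ?] := h 1%N 0%N 5%N isT isT isT; have [? ?] := h 1%N 1%N 7%N isT isT isT; have [? ?] := h 1%N 2%N 2%N isT isT isT; have [? ?] := h 2%N 0%N 3%N isT isT isT; have [? ?] := h 2%N 1%N 1%N isT isT isT; have [? ?] := h 2%N 2%N 7%N isT isT isT; split; lra.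
Qed.

Lemma within_comp (W : topologicalType) (u : R -> 'rV[R]_9) (F : 'rV[R]_9 -> W) (t : R) :
  {within `[0, t], continuous u} -> (forall s, 0 <= s <= t -> {for u s, continuous F}) ->
  {within `[0, t], continuous (F \o u)}.
Proof.
move=> /subspace_continuousP cu cF; apply/subspace_continuousP => s /= hs.
apply: cvg_comp (cu s hs) _; apply: cF.
by move: hs; rewrite in_itv.
Qed.

Lemma differentiable_fsqr (V : normedModType R) (f : V -> R) (x : V) : differentiable f x ->
  differentiable (fun y => f y ^+ 2) x.
Proof. by move=> d; exact: differentiable_fmul. Qed.

Lemma differentiable_adjcoord k x : (k < 9)%N ->
  differentiable (fun y => (adjcoord y).[: k]) x.
Proof.
move=> k9; under eq_fun do rewrite row9E // /adjseq.
have X i : differentiable (fun y : 'rV[R]_9 => y.[: i]) x by exact: differentiable_coord.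
have A := @differentiable_fadd R 'rV[R]_9.
have N := @differentiable_fopp R 'rV[R]_9.
have M := @differentiable_fmul R 'rV[R]_9.
have Q := @differentiable_fsqr 'rV[R]_9.
by case: k k9 => [|[|[|[|[|[|[|[|[|//]]]]]]]]] _ /=;
  do ?[exact: X|apply: (Q)|apply: (M)|apply: (N)|apply: (A)].
Qed.

Definition adjnorm2 x : R := \sum_(k < 9) (adjcoord x).[: k] ^+ 2.

Lemma adjnorm2_continuous : continuous adjnorm2.
Proof.
move=> x; apply: differentiable_continuous.
have -> : adjnorm2 = \sum_(k < 9) (fun y => (adjcoord y).[: k] ^+ 2).
  by apply/funext => y; rewrite fct_sumE.
by apply: differentiable_sum => k; apply: differentiable_fsqr; exact: differentiable_adjcoord.
Qed.

(** Gronwall is applied to the squared norm of the adjugate. Its derivative has nine terms, each at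
    most [2 r * c * 6 C r] with [r] the norm, which gives the rate [108 * c * C]. *)
Lemma adjcoord_flow_eq0 (u : R -> 'rV[R]_9) (t c C : R) : 0 <= t -> 0 <= c ->
  {within `[0, t], continuous u} ->
  (forall s k, 0 < s < t -> (k < 9)%N ->
     is_derive s 1 (fun s => (u s).[: k]) (c * nth 0 (rate g (u s)) k)) ->
  (forall s i j, 0 < s < t -> (i < 3)%N -> (j < 3)%N -> `|relMx (u s) i j| <= C) ->
  adjcoord (u 0) = 0 -> adjcoord (u t) = 0.
Proof.
move=> t0 c0 cu du hC a0.
pose e s k := (adjcoord (u s)).[: k].
pose de s k := c * nth 0 (rateM (transposed (relMx (u s))) (adjcoord (u s))) k.
have De s k : 0 < s < t -> (k < 9)%N -> is_derive s 1 (fun s => e s k) (de s k).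
  by move=> hs k9; apply: is_derive_adjcoord => // l l9; rewrite -rateE; exact: du.
have cN : {within `[0, t], continuous (adjnorm2 \o u)}.
  by apply: within_comp => // s _; exact: adjnorm2_continuous.
have DN s : 0 < s < t -> is_derive s 1 (adjnorm2 \o u) (\sum_(k < 9) 2 * e s k * de s k).
  move=> hs.
  have -> : adjnorm2 \o u = \sum_(k < 9) (fun s => e s k ^+ 2).
    by apply/funext => r; rewrite fct_sumE.
  by apply: is_derive_sum => k; apply: is_derive_fsqr; exact: De.
have bound s : 0 < s < t -> \sum_(k < 9) 2 * e s k * de s k <= 108 * c * C * adjnorm2 (u s).
  move=> hs; have N0 : 0 <= adjnorm2 (u s) by apply: sumr_ge0 => k _; exact: sqr_ge0.
  pose r := Num.sqrt (adjnorm2 (u s)).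
  have r0 : 0 <= r by exact: sqrtr_ge0.
  have r2 : r ^+ 2 = adjnorm2 (u s) by rewrite sqr_sqrtr.
  have er k : (k < 9)%N -> `|e s k| <= r.
    move=> k9; rewrite -(ler_pXn2r (ltn0Sn 1)) ?nnegrE // r2 real_normK ?num_real //.
    rewrite /adjnorm2 (bigD1 (Ordinal k9)) //= lerDl; apply: sumr_ge0 => l _; exact: sqr_ge0.
  have C0 : 0 <= C by apply: le_trans (hC s 0%N 0%N hs isT isT).
  have -> : 108 * c * C * adjnorm2 (u s) = \sum_(k < 9) 12 * c * C * adjnorm2 (u s).
    by rewrite sumr_const card_ord -mulr_natl; move: (adjnorm2 _) => N; ring.
  apply: ler_sum => k _; apply: le_trans (ler_norm _) _.
  rewrite /de !normrM (ger0_norm c0) (ger0_norm (ler0n R 2)) -r2.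
  have h : `|nth 0 (rateM (transposed (relMx (u s))) (adjcoord (u s))) k| <= 6 * C * r.
    by apply: rateM_bound => // i j i3 j3; exact: hC.
  rewrite (_ : 12 * c * C * r ^+ 2 = 2 * r * (c * (6 * C * r))); last by ring.
  apply: ler_pM; rewrite ?mulr_ge0 //; first by rewrite ler_wpM2l // er.
  by rewrite ler_wpM2l.
have N00 : (adjnorm2 \o u) 0 = 0.
  by rewrite /= /adjnorm2 a0 big1 // => k _; rewrite mxE expr0n.
have := gronwall0 t0 cN DN bound N00 => /= hN.
have NT : adjnorm2 (u t) == 0 by rewrite eq_le hN; apply: sumr_ge0 => k _; exact: sqr_ge0.
apply/row9P => k k9; rewrite [RHS]mxE.
move: NT; rewrite psumr_eq0; last by move=> l _; exact: sqr_ge0.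
by move=> /allP /(_ (Ordinal k9)); rewrite mem_index_enum => /(_ isT); rewrite sqrf_eq0 => /eqP.
Qed.

(** The sum of [Gamma_i Gamma_j |q_i - q_j|^2] over all pairs, the diagonal coordinates being the
    squared distances to the fourth vortex; [energy] is the same sum with logarithms. *)
Definition impulse x : R := x.[: 0] + x.[: 1] - 2 * x.[: 3] + g ^+ 2 * x.[: 2] +
  g * (x.[: 0] + x.[: 1] + (x.[: 0] + x.[: 2] - 2 * x.[: 5]) + (x.[: 1] + x.[: 2] - 2 * x.[: 7])).

Definition energy x : R := ln (x.[: 0] + x.[: 1] - 2 * x.[: 3]) + g ^+ 2 * ln x.[: 2] +
  g * (ln x.[: 0] + ln x.[: 1] + ln (x.[: 0] + x.[: 2] - 2 * x.[: 5]) + ln (x.[: 1] + x.[: 2] - 2 * x.[: 7])).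

Lemma has_deriv_ln (f : R -> R) (t df : R) : has_deriv f t 1 df -> 0 < f t ->
  has_deriv (fun s => ln (f s)) t 1 (df * (f t)^-1).
Proof. by move=> hf f0; exact: is_derive_fln. Qed.

Section Conserved.
Variables (u : R -> 'rV[R]_9) (t c : R).
Hypothesis du : forall k, (k < 9)%N ->
  is_derive t 1 (fun s => (u s).[: k]) (c * nth 0 (rate g (u t)) k).

(** The Casimir property: the derivative cancels whatever values are given to the six inverse
    squared distances. *)
Lemma is_derive_impulse : is_derive t 1 (impulse \o u) 0.
Proof.
suff [d [dk <-]] : exists d, has_deriv (fun s => impulse (u s)) t 1 d /\ d = 0 by [].
have X : forall k, (k < 9)%N -> has_deriv (fun s => (u s).[: k]) t 1 (c * nth 0 (rate g (u t)) k) := du.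
have A := @has_derivD R R.
have N := @has_derivN R R.
have P := @has_derivM R R.
have C := @has_deriv_cst R R.
rewrite /impulse; eexists; (split; [
  do ?[by apply: X|exact: C|apply: (P)|apply: (N)|apply: (A)]|]).
rewrite rateE /rateM /relMx /relM /=.
move: (u t) => x; clear -g.
move: (x.[: 0]^-1) (x.[: 1]^-1) (x.[: 2]^-1) (x.[: 0] + x.[: 1] - 2 * x.[: 3])^-1
    (x.[: 0] + x.[: 2] - 2 * x.[: 5])^-1 (x.[: 1] + x.[: 2] - 2 * x.[: 7])^-1
  => r1 r2 r3 r12 r13 r23.
gen9 x; ring.
Qed.

(** The logarithms produce exactly the inverses that occur in the vector field; with these as
    independent variables the cancellation is the skew-symmetry of the bracket. *)
Lemma is_derive_energy : hdomain (u t) -> is_derive t 1 (energy \o u) 0.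
Proof.
move=> /hdomainE [[h0 h1 h2] [h3 h4 h5]].
suff [d [dk <-]] : exists d, has_deriv (fun s => energy (u s)) t 1 d /\ d = 0 by [].
have X : forall k, (k < 9)%N -> has_deriv (fun s => (u s).[: k]) t 1 (c * nth 0 (rate g (u t)) k) := du.
have A := @has_derivD R R.
have N := @has_derivN R R.
have P := @has_derivM R R.
have C := @has_deriv_cst R R.
have L := @has_deriv_ln.
rewrite /energy; eexists; (split; [
  do ?[by apply: X|exact: C|apply: (L) => //|apply: (P)|apply: (N)|apply: (A)]|]).
rewrite rateE /rateM /relMx /relM /=.
move: (u t) => x; clear -g.
move: (x.[: 0]^-1) (x.[: 1]^-1) (x.[: 2]^-1) (x.[: 0] + x.[: 1] - 2 * x.[: 3])^-1
    (x.[: 0] + x.[: 2] - 2 * x.[: 5])^-1 (x.[: 1] + x.[: 2] - 2 * x.[: 7])^-1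
  => r1 r2 r3 r12 r13 r23.
gen9 x; ring.
Qed.

End Conserved.

Lemma energy_continuous x : hdomain x -> {for x, continuous energy}.
Proof.
move=> /hdomainE [[h0 h1 h2] [h3 h4 h5]].
have X i : differentiable (fun y : 'rV[R]_9 => y.[: i]) x by exact: differentiable_coord.
have J i j l : differentiable (fun y : 'rV[R]_9 => y.[: i] + y.[: j] - 2 * y.[: l]) x.
  apply: (differentiable_fadd (differentiable_fadd (X _) (X _))).
  by apply: differentiable_fopp; apply: differentiable_fmul (X _); exact: differentiable_cst.
have L (f : 'rV[R]_9 -> R) : differentiable f x -> 0 < f x -> {for x, continuous (fun y => ln (f y))}.
  move=> df fx; apply: (continuous_comp (g := @ln R)); last exact: continuous_ln.
  exact: differentiable_continuous.
have A (f h : 'rV[R]_9 -> R) : {for x, continuous f} -> {for x, continuous h} ->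
  {for x, continuous (fun y => f y + h y)}.
  by move=> cf ch; exact: (cvgD cf ch).
have M (f : 'rV[R]_9 -> R) (k : R) : {for x, continuous f} -> {for x, continuous (fun y => k * f y)}.
  by move=> cf; exact: (cvgM (cvg_cst _) cf).
rewrite /energy.
have L0 := L _ (X _) h0; have L1 := L _ (X _) h1; have L2 := L _ (X _) h2.
have L3 := L _ (J _ _ _) h3; have L4 := L _ (J _ _ _) h4; have L5 := L _ (J _ _ _) h5.
exact: A (A _ _ L3 (M _ _ L2)) (M _ _ (A _ _ (A _ _ (A _ _ L0 L1) L4) L5)).
Qed.

Lemma impulse_continuous : continuous impulse.
Proof.
move=> x; apply: differentiable_continuous.
have X i : differentiable (fun y : 'rV[R]_9 => y.[: i]) x by exact: differentiable_coord.
have C a : differentiable (fun y : 'rV[R]_9 => a : R) x by exact: differentiable_cst.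
have A := @differentiable_fadd R 'rV[R]_9.
have N := @differentiable_fopp R 'rV[R]_9.
have M := @differentiable_fmul R 'rV[R]_9.
by rewrite /impulse; do ?[exact: X|exact: C|apply: (M)|apply: (N)|apply: (A)].
Qed.

Lemma solution_coord (X : 'rV[R]_9 -> 'rV[R]_9) (D : set 'rV[R]_9) (T t : R) (u : R -> 'rV[R]_9) k :
  is_solution D X T u -> 0 < t < T -> is_derive t 1 (fun s => (u s).[: k]) (X (u t)).[: k].
Proof.
move=> [_ _ h] ht; have [d <-] := h t ht.
split; first by move/derivable_mxP: d; apply.
by rewrite (derive_mx d) mxE.
Qed.

Lemma conserved_on (F : 'rV[R]_9 -> R) (u : R -> 'rV[R]_9) (T t : R) :
  0 <= t < T -> {within `[0, T[, continuous u} ->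
  (forall s, 0 <= s <= t -> {for u s, continuous F}) ->
  (forall s, 0 < s < t -> is_derive s 1 (F \o u) 0) -> F (u t) = F (u 0).
Proof.
move=> /andP[t0 tT] cu cF dF.
apply: (const_of_derive0 (f := F \o u)) => //.
by apply: within_comp => //; exact: within_sub cu.
Qed.

Lemma relM_bound (r1 r2 r3 r12 r13 r23 : R) i j : -1 < g < 1 -> `|r1| <= 1 -> `|r2| <= 1 -> `|r3| <= 1 ->
  `|r12| <= 1 -> `|r13| <= 1 -> `|r23| <= 1 -> (i < 3)%N -> (j < 3)%N ->
  `|relM g r1 r2 r3 r12 r13 r23 i j| <= 4.
Proof.
move=> /andP[gN1 g1] h1 h2 h3 h4 h5 h6.
have hg : `|g| <= 1 by rewrite ler_norml; apply/andP; split; lra.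
have hgg : `|1 + g| <= 2 by rewrite ler_norml; apply/andP; split; lra.
have gm (r : R) : `|r| <= 1 -> `|g * r| <= 1 by move=> hr; rewrite normrM mulr_ile1.
have hm (r : R) : `|r| <= 1 -> `|(1 + g) * r| <= 2.
  by move=> hr; rewrite normrM -[leRHS]mulr1; apply: ler_pM.
have hm2 : `|2 * g * r3| <= 2.
  by rewrite -mulrA normrM (ger0_norm (ler0n R 2)) -[leRHS]mulr1 ler_wpM2l // gm.
have D (a b k l : R) : `|a| <= k -> `|b| <= l -> `|a + b| <= k + l.
  by move=> ha hb; apply: le_trans (ler_normD _ _) _; exact: lerD.
have DB (a b k l : R) : `|a| <= k -> `|b| <= l -> `|a - b| <= k + l.
  by move=> ha hb; apply: D => //; rewrite normrN.
have G13 := gm _ h5; have G23 := gm _ h6.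
case: i => [|[|[|//]]] _; case: j => [|[|[|//]]] _; rewrite /relM /=.
- by apply: le_trans (D _ _ _ _ (D _ _ _ _ (hm _ h1) h4) G13) _; lra.
- by apply: le_trans (DB _ _ _ _ h2 h4) _; lra.
- by rewrite mulrBr; apply: le_trans (DB _ _ _ _ (gm _ h3) G13) _; lra.
- by apply: le_trans (DB _ _ _ _ h1 h4) _; lra.
- by apply: le_trans (D _ _ _ _ (D _ _ _ _ (hm _ h2) h4) G23) _; lra.
- by rewrite mulrBr; apply: le_trans (DB _ _ _ _ (gm _ h3) G23) _; lra.
- by apply: le_trans (DB _ _ _ _ h1 h5) _; lra.
- by apply: le_trans (DB _ _ _ _ h2 h6) _; lra.
- by apply: le_trans (D _ _ _ _ (D _ _ _ _ hm2 h5) h6) _; lra.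
Qed.

End Flow.

(** * Jacobi coordinates on rank-one elements *)

Section RankOne.
Variable R : realType.
Implicit Types x : 'rV[R]_9.

Lemma FmapE x : Fmap x =
  (x.[: 0] * x.[: 1] - (x.[: 3] ^+ 2 + x.[: 4] ^+ 2),
   x.[: 1] * x.[: 2] - (x.[: 7] ^+ 2 + x.[: 8] ^+ 2),
   ((x.[: 3] * x.[: 7] - x.[: 4] * x.[: 8] - x.[: 5] * x.[: 1]) +i*
    (x.[: 3] * x.[: 8] + x.[: 4] * x.[: 7] - x.[: 6] * x.[: 1]))%C).
Proof.
rewrite /Fmap !mud3E.
have -> : muo x 0 1 = (x.[: 3] +i* x.[: 4])%C by rewrite /muo mxE.
have -> : muo x 1 2 = (x.[: 7] +i* x.[: 8])%C by rewrite /muo mxE.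
have -> : muo x 0 2 = (x.[: 5] +i* x.[: 6])%C by rewrite /muo mxE.
rewrite /= !sqr_sqrtr ?addr_ge0 ?sqr_ge0 //; congr (_, _, _).
by apply/eqP; rewrite eq_complex /=; apply/andP; split; apply/eqP; gen9 x; ring.
Qed.

(** Since [mu_2] is nonzero it serves as a pivot: the constraint expresses [mu_1], [mu_3] and
    [mu_13] through the second row and column, and the remaining minors vanish after
    substitution. *)
Lemma F0_adjcoord x : F0 x -> adjcoord x = 0.
Proof.
move=> [[/(_ 1) x1 _]]; rewrite mudE in x1; rewrite /= FmapE => -[E2 E0 E5 E6].
have {}x1 : x.[: 1] != 0 by [].
apply/row9P => k k9; rewrite row9E // /adjseq [RHS]mxE.
move: E2 E0 E5 E6 x1; gen9 x => E2 E0 E5 E6 X1.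
have x0E : x0 = (x3 ^+ 2 + x4 ^+ 2) / x1 by rewrite -[LHS](mulfK X1); congr (_ / _); lra.
have x2E : x2 = (x7 ^+ 2 + x8 ^+ 2) / x1 by rewrite -[LHS](mulfK X1); congr (_ / _); lra.
have x5E : x5 = (x3 * x7 - x4 * x8) / x1 by rewrite -[LHS](mulfK X1); congr (_ / _); lra.
have x6E : x6 = (x3 * x8 + x4 * x7) / x1 by rewrite -[LHS](mulfK X1); congr (_ / _); lra.
rewrite x0E x2E x5E x6E.
by case: k k9 => [|[|[|[|[|[|[|[|[|//]]]]]]]]] _ /=; field.
Qed.

Lemma adjcoord_Fmap x : adjcoord x = 0 -> Fmap x = (0, 0, 0).
Proof.
move=> /rowP h; have {}h k : (adjcoord x).[: k] = 0 by rewrite h mxE.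
have := (h 0%N, h 2%N, h 5%N, h 6%N); rewrite !row9E // /adjseq /= => -[[[h0 h2] h5] h6].
by rewrite FmapE h5 h6 opprD addrA h2 opprD addrA h0.
Qed.

(* The entries of [A] in the basis of the Jacobi vectors, e.g. [re_bc] is [Re (b c^* )]. *)
Definition sq_a x := x.[: 0] + x.[: 1] - 2 * x.[: 3].
Definition sq_c x := (x.[: 0] + x.[: 1] + x.[: 2] + 2 * x.[: 3] - 2 * x.[: 5] - 2 * x.[: 7]) / 4.
Definition re_ab x := x.[: 5] - x.[: 7].
Definition im_ab x := x.[: 6] - x.[: 8].
Definition re_ac x := (x.[: 0] - x.[: 1] - x.[: 5] + x.[: 7]) / 2.
Definition im_ac x := (2 * x.[: 4] - x.[: 6] + x.[: 8]) / 2.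
Definition re_bc x := (x.[: 5] + x.[: 7] - x.[: 2]) / 2.
Definition im_bc x := - (x.[: 6] + x.[: 8]) / 2.

(** The Jacobi vectors are linear in the relative positions, so the minors in the new basis are
    linear combinations of the old ones. *)
Lemma rank1_jacobi x : adjcoord x = 0 ->
  [/\ sq_a x * x.[: 2] = re_ab x ^+ 2 + im_ab x ^+ 2,
      sq_a x * sq_c x = re_ac x ^+ 2 + im_ac x ^+ 2,
      sq_a x * re_bc x = re_ab x * re_ac x + im_ab x * im_ac x &
      sq_a x * im_bc x = re_ab x * im_ac x + (- im_ab x) * re_ac x].
Proof.
move=> /rowP h; have {}h k : (adjcoord x).[: k] = 0 by rewrite h mxE.
have := (h 0%N, h 1%N, h 2%N, h 3%N, h 4%N, h 5%N, h 6%N, h 7%N, h 8%N).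
rewrite !row9E // /adjseq /= => -[[[[[[[[h0 h1] h2] h3] h4] h5] h6] h7] h8] {h}.
rewrite /sq_a /sq_c /re_ab /im_ab /re_ac /im_ac /re_bc /im_bc.
move: h0 h1 h2 h3 h4 h5 h6 h7 h8; gen9 x => *; split; rewrite ?expr2; lra.
Qed.

Definition eqdist (b : R) x : R := \sum_(k < 9) (x.[: k] - (equilibrium b).[: k]) ^+ 2.

Lemma eqdist_continuous b : continuous (eqdist b).
Proof.
move=> x; apply: differentiable_continuous.
have -> : eqdist b =
    \sum_(k < 9) (fun y : 'rV[R]_9 => (y.[: k] - (equilibrium b).[: k]) ^+ 2 : R).
  by apply/funext => y; rewrite fct_sumE.
apply: differentiable_sum => k; apply: differentiable_fsqr.
by apply: differentiable_fadd; [exact: differentiable_coord|exact: differentiable_cst].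
Qed.

Lemma eqdist_coord b x k (r : R) : (k < 9)%N -> 0 <= r -> eqdist b x <= r ^+ 2 ->
  `|x.[: k] - (equilibrium b).[: k]| <= r.
Proof.
move=> k9 r0 h; rewrite -(ler_pXn2r (ltn0Sn 1)) ?nnegrE // real_normK ?num_real //.
apply: le_trans h; rewrite /eqdist (bigD1 (Ordinal k9)) //= lerDl.
by apply: sumr_ge0 => l _; exact: sqr_ge0.
Qed.

Lemma jacobi_close b x (e : R) : 0 <= e ->
  (forall k, (k < 9)%N -> `|x.[: k] - (equilibrium b).[: k]| <= e) ->
  [/\ `|sq_a x - 4| <= 4 * e, `|x.[: 2] - 4 * b ^+ 2| <= 4 * e, `|sq_c x| <= 4 * e & `|re_ab x| <= 4 * e] /\
  [/\ `|im_ab x + 4 * b| <= 4 * e, `|re_ac x| <= 4 * e & `|re_bc x| <= 4 * e].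
Proof.
move=> e0 h.
have := (h 0%N isT, h 1%N isT, h 2%N isT, h 3%N isT, h 5%N isT, h 6%N isT, h 7%N isT, h 8%N isT).
rewrite !row9E //= !ler_norml /sq_a /sq_c /re_ab /im_ab /re_ac /re_bc.
move=> [[[[[[[/andP[? ?] /andP[? ?]] /andP[? ?]] /andP[? ?]] /andP[? ?]] /andP[? ?]] /andP[? ?]] /andP[? ?]] {h}.
by do !split; apply/andP; split; lra.
Qed.

End RankOne.

Section Distance.
Variable R : realType.
Implicit Types x : 'rV[R]_9.

(** Rank-one elements form a manifold of dimension five, on which these five quantities are
    coordinates near the equilibrium. *)
Definition jacobi_dist (b : R) x := (sq_a x - 4) ^+ 2 + (x.[: 2] - 4 * b ^+ 2) ^+ 2 + re_ab x ^+ 2 + re_ac x ^+ 2 + im_ac x ^+ 2.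

(** On rank-one elements [n^2] is a function of [p], [q], [m]. Factoring [n^2 - 16 b^2] and bounding
    [n - 4 b] away from 0, as [n] is near [- 4 b], picks the right root. *)
Lemma rank1_n_bound (b p q m n r : R) : 1 < b -> `|p - 4| <= r -> `|q - 4 * b ^+ 2| <= r -> `|m| <= r ->
  `|p - 4| <= 1 -> `|m| <= 1 -> `|n + 4 * b| <= 1 ->
  p * q = m ^+ 2 + n ^+ 2 -> `|n + 4 * b| <= (6 + 4 * b ^+ 2) * r.
Proof.
move=> b1 hp hq hm p1 m1 hn E.
have E2 : (n + 4 * b) * (n - 4 * b) = 4 * (q - 4 * b ^+ 2) + 4 * b ^+ 2 * (p - 4)
    + (p - 4) * (q - 4 * b ^+ 2) - m ^+ 2.
  have -> : (n + 4 * b) * (n - 4 * b) = (p * q - m ^+ 2) - 16 * b ^+ 2 by rewrite E; ring.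
  by ring.
have n4 : 1 <= `|n - 4 * b|.
  move: hn; rewrite ler_norml => /andP[_ ?].
  by rewrite ltr0_norm; lra.
apply: le_trans (_ : `|n + 4 * b| * `|n - 4 * b| <= _); first by rewrite ler_peMr.
rewrite -normrM E2.
have r0 : 0 <= r by apply: le_trans hm.
have h1 : `|4 * (q - 4 * b ^+ 2)| <= 4 * r by rewrite normrM (ger0_norm (ler0n R 4)) ler_wpM2l.
have h2 : `|4 * b ^+ 2 * (p - 4)| <= 4 * b ^+ 2 * r.
  have b4 : 0 <= 4 * b ^+ 2 by rewrite mulr_ge0 ?sqr_ge0.
  by rewrite normrM (ger0_norm b4) ler_wpM2l.
have h3 : `|(p - 4) * (q - 4 * b ^+ 2)| <= 1 * r by rewrite normrM; apply: ler_pM.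
have h4 : `|m ^+ 2| <= 1 * r by rewrite normrX expr2; apply: ler_pM.
apply: le_trans (ler_normB _ _) _; apply: le_trans (lerD (ler_normD _ _) h4) _.
apply: le_trans (lerD (lerD (ler_normD _ _) h3) (lexx _)) _.
by apply: le_trans (lerD (lerD (lerD h1 h2) (lexx _)) (lexx _)) _; lra.
Qed.

(** On rank-one elements the dependent Jacobi quantities are controlled by the five in
    [jacobi_dist], hence so are the nine matrix coordinates, each up to the factor [K]. This
    converts the lower bound on the Lyapunov function into one in the Euclidean distance. *)
Lemma eqdist_le b x : 1 < b -> adjcoord x = 0 ->
  `|sq_a x - 4| <= 1 -> `|sq_c x| <= 1 -> `|re_ab x| <= 1 -> `|im_ab x + 4 * b| <= 1 ->
  eqdist b x <= 9 * (7 + (1 + (4 * b + 1) ^+ 2) + 2 * b ^+ 2) ^+ 2 * jacobi_dist b x.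
Proof.
move=> b1 rx p1 l1 m1 n1.
have [Epq Epl Epw Epy] := rank1_jacobi rx.
set k := 1 + (4 * b + 1) ^+ 2.
set N := jacobi_dist b x.
have N0 : 0 <= N by rewrite /N /jacobi_dist !addr_ge0 ?sqr_ge0.
pose r : R := Num.sqrt N.
have r0 : 0 <= r by exact: sqrtr_ge0.
have r2 : r ^+ 2 = N by rewrite sqr_sqrtr.
have sq (z : R) : z ^+ 2 <= N -> `|z| <= r.
  by move=> h; rewrite -(ler_pXn2r (ltn0Sn 1)) ?nnegrE // real_normK ?num_real // r2.
have hp : `|sq_a x - 4| <= r by apply: sq; rewrite /N /jacobi_dist -!addrA lerDl !addr_ge0 ?sqr_ge0.
have hq : `|x.[: 2] - 4 * b ^+ 2| <= r.
  by apply: sq; rewrite /N /jacobi_dist -!addrA addrCA lerDl !addr_ge0 ?sqr_ge0.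
have hm : `|re_ab x| <= r.
  by apply: sq; rewrite /N /jacobi_dist -addrA [_ + re_ab x ^+ 2]addrC -addrA lerDl !addr_ge0 ?sqr_ge0.
have uvN : re_ac x ^+ 2 + im_ac x ^+ 2 <= N.
  by rewrite /N /jacobi_dist -addrA lerDr !addr_ge0 ?sqr_ge0.
have hu : `|re_ac x| <= r by apply: sq; apply: le_trans uvN; rewrite lerDl sqr_ge0.
have hv : `|im_ac x| <= r by apply: sq; apply: le_trans uvN; rewrite lerDr sqr_ge0.
have hn := rank1_n_bound b1 hp hq hm p1 m1 n1 Epq.
have [l0 lle _] := rank1_l_bounds p1 (lexx 1) l1 Epl.
have hl : `|sq_c x| <= r.
  apply: sq; rewrite expr2; apply: le_trans (_ : 1 * sq_c x <= _).
    by rewrite ler_wpM2r // (le_trans (ler_norm _) l1).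
  by rewrite mul1r (le_trans lle).
have p3 : 3 <= sq_a x by move: p1; rewrite ler_norml => /andP[]; lra.
have nb : `|im_ab x| <= 4 * b + 1.
  by move: n1; rewrite !ler_norml => /andP[? ?]; apply/andP; split; lra.
have nb' : `|- im_ab x| <= 4 * b + 1 by rewrite normrN.
have k1 : 1 <= k by rewrite /k lerDl sqr_ge0.
have wk (z : R) : z ^+ 2 <= k * (re_ac x ^+ 2 + im_ac x ^+ 2) -> `|z| <= k * r.
  move=> h; rewrite -(ler_pXn2r (ltn0Sn 1)) ?nnegrE //; last by rewrite mulr_ge0 // (le_trans ler01).
  rewrite real_normK ?num_real // exprMn r2; apply: le_trans h _.
  apply: ler_pM => //; rewrite ?addr_ge0 ?sqr_ge0 ?(le_trans ler01) //.
  by rewrite expr2 ler_peMr // (le_trans ler01).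
have hw : `|re_bc x| <= k * r by apply: wk; exact: rank1_w_le p3 m1 nb Epw.
have hy : `|im_bc x| <= k * r.
  by apply: wk; rewrite addrC; apply: rank1_w_le p3 m1 nb' Epy.
set K := 7 + k + 2 * b ^+ 2.
have B2 : 0 <= b ^+ 2 * r by rewrite mulr_ge0 ?sqr_ge0.
have kr : r <= k * r by rewrite ler_peMl.
have dev i : (i < 9)%N -> `|x.[: i] - (equilibrium b).[: i]| <= K * r.
  move=> i9; rewrite row9E //.
  have -> : K * r = 7 * r + k * r + 2 * (b ^+ 2 * r) by rewrite /K; ring.
  have hn' : `|im_ab x + 4 * b| <= 6 * r + 4 * (b ^+ 2 * r) by rewrite mulrA -mulrDl.
  move: hp hq hl hm hn' hu hv hw hy kr B2 r0 i9; rewrite !ler_norml /sq_a /sq_c /re_ab /im_ab /re_ac /im_ac /re_bc /im_bc.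
  move: (k * r) (b ^+ 2) => kr B; move: (B * r) => Br.
  clear -r; case: i => [|[|[|[|[|[|[|[|[|//]]]]]]]]] + + + + + + + + + + + + _ /=; gen9 x;
    move=> /andP[? ?] /andP[? ?] /andP[? ?] /andP[? ?] /andP[? ?] /andP[? ?] /andP[? ?] /andP[? ?] /andP[? ?] ? ? ?;
    by apply/andP; split; lra.
have K0 : 0 <= K.
  by have := sqr_ge0 b; move: k1; rewrite /K; move: (k) (b ^+ 2); clear => *; lra.
rewrite /eqdist (_ : 9 * K ^+ 2 * N = \sum_(i < 9) (K * r) ^+ 2); last first.
  by rewrite sumr_const card_ord exprMn r2 -mulr_natl; move: (K) (N) => *; ring.
apply: ler_sum => i _; rewrite -[X in X <= _]real_normK ?num_real //.
by rewrite lerXn2r ?nnegrE ?mulr_ge0 //; exact: dev.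
Qed.

End Distance.

Section LyapunovFunction.
Variables (R : realType) (g b : R).
Implicit Types x : 'rV[R]_9.

Definition lyapx kap x := lyap b kap (sq_a x) x.[: 2] (sq_c x) (re_ab x) (re_ac x) (re_bc x).

Hypothesis gE : g = b ^+ 2 * (3 - b ^+ 2) / (3 * b ^+ 2 - 1).

Lemma dimpulseE x : dimpulse b (sq_a x) x.[: 2] (sq_c x) = impulse g x - impulse g (equilibrium b).
Proof.
by rewrite /dimpulse -gE /impulse !row9E //= /sq_a /sq_c; gen9 x; field.
Qed.

Lemma denergyE x : 0 < b -> hdomain x ->
  denergy b (sq_a x) x.[: 2] (sq_c x) (re_ab x) (re_ac x) (re_bc x) = energy g x - energy g (equilibrium b).
Proof.
move=> b0 /hdomainE [[h0 h1 h2] [h3 h4 h5]].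
have lnq (s t : R) : 0 < s -> 0 < t -> ln (s / t) = ln s - ln t.
  by move=> s0 t0; rewrite ln_div.
have b2 : 0 < b ^+ 2 by rewrite exprn_gt0.
have S0 : 0 < 1 + b ^+ 2 by lra.
have a4 : 0 < 4 * b ^+ 2 by lra.
rewrite /denergy -gE.
have -> : sq_c x + (sq_a x + x.[: 2]) / 4 + re_ac x - re_bc x - re_ab x / 2 = x.[: 0] + x.[: 2] - 2 * x.[: 5].
  by rewrite /sq_c /sq_a /re_ac /re_bc /re_ab; gen9 x; field.
have -> : sq_c x + (sq_a x + x.[: 2]) / 4 + re_ac x + re_bc x + re_ab x / 2 = x.[: 0].
  by rewrite /sq_c /sq_a /re_ac /re_bc /re_ab; gen9 x; field.
have -> : sq_c x + (sq_a x + x.[: 2]) / 4 - re_ac x - re_bc x + re_ab x / 2 = x.[: 1] + x.[: 2] - 2 * x.[: 7].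
  by rewrite /sq_c /sq_a /re_ac /re_bc /re_ab; gen9 x; field.
have -> : sq_c x + (sq_a x + x.[: 2]) / 4 - re_ac x + re_bc x - re_ab x / 2 = x.[: 1].
  by rewrite /sq_c /sq_a /re_ac /re_bc /re_ab; gen9 x; field.
have p0 : 0 < sq_a x by exact: h3.
have f0 : 0 < 4 :> R by [].
rewrite !lnq //.
rewrite /energy !row9E //=.
have -> : b ^+ 2 + 1 + (b ^+ 2 + 1) - 2 * (b ^+ 2 - 1) = 4 by ring.
have -> : b ^+ 2 + 1 + 4 * b ^+ 2 - 2 * (2 * b ^+ 2) = 1 + b ^+ 2 by ring.
rewrite [b ^+ 2 + 1]addrC /sq_a.
move: (ln _) (ln (4 * b ^+ 2)); move: (ln _) (ln _) (ln _) (ln _) (ln _) (ln _) (ln _) => *; ring.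
Qed.

Lemma lyapx_continuous kap x : 0 < b -> hdomain x -> {for x, continuous (lyapx kap)}.
Proof.
move=> b0 hx.
pose A := (1 / 4 + g / (1 + b ^+ 2)) / (1 + g).
pose F y := (A * (impulse g y - impulse g (equilibrium b))
   - (energy g y - energy g (equilibrium b))) / g
   + kap * (impulse g y - impulse g (equilibrium b)) ^+ 2.
have FE : \forall y \near x, F y = lyapx kap y.
  apply: filterS (hdomain_open hx) => y hy.
  by rewrite /F /lyapx /lyap -!dimpulseE -denergyE // -gE.
have Fx : F x = lyapx kap x := nbhs_singleton FE.
have ci : {for x, continuous (impulse g)} by exact: impulse_continuous.
have ce : {for x, continuous (energy g)} by exact: energy_continuous.
have c1 : {for x, continuous (fun y => impulse g y - impulse g (equilibrium b))}.
  by exact: (cvgB ci (cvg_cst _)).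
have c2 : {for x, continuous (fun y => energy g y - energy g (equilibrium b))}.
  by exact: (cvgB ce (cvg_cst _)).
have cF : F y @[y --> x] --> F x.
  exact: (cvgD (cvgM (cvgB (cvgM (cvg_cst A) c1) c2) (cvg_cst g^-1)) (cvgM (cvg_cst kap) (cvgM c1 c1))).
rewrite Fx in cF; apply: cvg_trans cF; exact: near_eq_cvg FE.
Qed.

Lemma lyapx_equilibrium kap : 0 < b -> lyapx kap (equilibrium b) = 0.
Proof.
move=> b0; rewrite /lyapx /lyap dimpulseE denergyE // ?subrr.
  by rewrite mulr0 subr0 mul0r add0r expr0n mulr0.
exact: hdomain_equilibrium.
Qed.

End LyapunovFunction.

(** * Stability *)

Section Stable.
Variable R : realType.
Implicit Types x : 'rV[R]_9.

Lemma nbhs_eqdist (b : R) (U : set 'rV[R]_9) : nbhs (equilibrium b) U ->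
  exists2 r, 0 < r & forall x, eqdist b x < r ^+ 2 -> U x.
Proof.
move=> /nbhs_ballP [r r0 hU]; exists (r / 2); first by rewrite divr_gt0.
move=> x hx; apply: hU; split=> // i j; rewrite (ord1 i) -(inord_val j).
rewrite /ball /= distrC; apply: le_lt_trans (eqdist_coord (ltn_ord j) _ (ltW hx)) _.
  by rewrite divr_ge0 // ltW.
by rewrite ltr_pdivrMr // ltr_pMr //; lra.
Qed.

Lemma eqdist_equilibrium (b : R) : eqdist b (equilibrium b) = 0.
Proof. by rewrite /eqdist big1 // => k _; rewrite subrr expr0n. Qed.

(** The off-diagonal entries are kept away from 0 by their imaginary parts, close to [- 2 b],
    [- 2 b] and [2 b] with [b > 1]; the real part of [mu_12] is [b^2 - 1] and can be arbitrarily
    small. *)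
Lemma vKring_near (b : R) x : 1 < b ->
  (forall k, (k < 9)%N -> `|x.[: k] - (equilibrium b).[: k]| <= 1 / 8) ->
  vKring x.
Proof.
move=> b1 h; have b2 : 1 < b ^+ 2 by rewrite exprn_egt1.
have := (h 0%N isT, h 1%N isT, h 2%N isT, h 4%N isT, h 6%N isT, h 8%N isT).
rewrite !row9E //= !ler_norml => -[[[[[/andP[h0 _] /andP[h1 _]] /andP[h2 _]] /andP[_ h4]] /andP[_ h6]] /andP[h8 _]].
split.
  case=> [[|[|[|//]]] ?]; rewrite mudE /=; apply/eqP; lra.
case=> [[|[|[|//]]] ?] [[|[|[|//]]] ?] //= _; rewrite /muo mxE /= eq_complex /= negb_and; apply/orP; right;
  apply/eqP; lra.
Qed.

Lemma relMx_near (g b : R) x i j : -1 < g < 1 -> 1 < b ->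
  (forall k, (k < 9)%N -> `|x.[: k] - (equilibrium b).[: k]| <= 1 / 8) ->
  (i < 3)%N -> (j < 3)%N -> `|relMx g x i j| <= 4.
Proof.
move=> hg b1 h i3 j3; have b2 : 1 < b ^+ 2 by rewrite exprn_egt1.
have inv (y : R) : 1 <= y -> `|y^-1| <= 1.
  move=> y1; have y0 : 0 < y by lra.
  by rewrite normfV gtr0_norm // invf_le1.
have := (h 0%N isT, h 1%N isT, h 2%N isT, h 3%N isT, h 5%N isT, h 7%N isT).
rewrite !row9E //= !ler_norml.
move=> [[[[[/andP[h0 h0'] /andP[h1 h1']] /andP[h2 h2']] /andP[h3 h3']] /andP[h4 h4']] /andP[h5 h5']].
by rewrite -ler_norml; apply: relM_bound => //; apply: inv; lra.
Qed.

Lemma rhombusA_stable (g : R) : -1 < g < 1 -> g != 0 -> 0 < g ^+ 2 + 4 * g + 1 ->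
  lyapunov_stable_in (hdomain (R := R)) (Xh (rhombus_circ g)) (F0 (R := R)) (mu0 g).
Proof.
move=> hg g0 gt; have /andP[gN1 g1] := hg.
have a1 := alphaA_gt1 g1.
have [b b1 hb] : exists2 b : R, 1 < b & b ^+ 2 = alphaA g.
  exists (Num.sqrt (alphaA g)); last by rewrite sqr_sqrtr //; lra.
  by rewrite -sqrtr1 ltr_sqrt //; lra.
have b0 : 0 < b by lra.
rewrite (mu0_equilibrium (ltW b0) hb).
have [_ thr] := alphaA_threshold hg; rewrite gt -hb in thr.
have [d0 E] := alphaA_param g1; rewrite -hb in d0 E.
have gn1 : 0 < 1 + g by lra.
have gn1' : 1 + g != 0 by rewrite gt_eqF.
have hx0 := hdomain_equilibrium b0.
have := @lyap_pos R b b1; rewrite -E => /(_ g0 gn1 g1 thr) [kap [c [e [c0 e0 e8 Hpos]]]].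
set mu := equilibrium b.
set K := 9 * (7 + (1 + (4 * b + 1) ^+ 2) + 2 * b ^+ 2) ^+ 2.
have K0 : 0 < K.
  rewrite mulr_gt0 // exprn_gt0 //; have := sqr_ge0 (4 * b + 1); have := sqr_ge0 b; lra.
(* Passing to the Jacobi quantities multiplies deviations by at most 4. *)
pose r0 : R := e / 4.
have r0p : 0 < r0 by rewrite divr_gt0.
have key x : adjcoord x = 0 -> eqdist b x <= r0 ^+ 2 -> eqdist b x <= K / c * lyapx b kap x.
  move=> rx dx.
  have dev k : (k < 9)%N -> `|x.[: k] - mu.[: k]| <= r0.
    by move=> k9; apply: eqdist_coord dx => //; exact: ltW.
  have [[H1 H2 H3 H4] [H5 H6 H7]] := jacobi_close (ltW r0p) dev.
  have er : 4 * r0 = e by rewrite /r0; field.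
  rewrite er in H1 H2 H3 H4 H5 H6 H7.
  have [E1 E2 E3 _] := rank1_jacobi rx.
  have e1 : e <= 1 by lra.
  have h1 := Hpos _ _ _ _ _ _ _ _ H1 H2 H3 H4 H5 H6 H7 E2 E3.
  apply: le_trans (eqdist_le b1 rx _ _ _ _) _; rewrite ?(le_trans _ e1) //.
  rewrite -/K -mulrA; apply: ler_wpM2l; first exact: ltW.
  by rewrite ler_pdivlMl //; exact: h1.
move=> U US hU.
have [r rp hr] : exists2 r, 0 < r & forall x, eqdist b x < r ^+ 2 -> F0 x -> U x.
  exact: nbhs_eqdist hU.
pose rho := Num.min r r0.
have rhop : 0 < rho by rewrite lt_min rp.
pose eta := rho ^+ 2.
have etap : 0 < eta by rewrite exprn_gt0.
have etar : eta <= r ^+ 2.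
  by rewrite lerXn2r ?nnegrE ?(ltW rhop) ?(ltW rp) // ge_min lexx.
have etar0 : eta <= r0 ^+ 2.
  by rewrite lerXn2r ?nnegrE ?(ltW rhop) ?(ltW r0p) // ge_min lexx orbT.
have hU' x : F0 x -> eqdist b x < eta -> U x.
  by move=> Fx dx; apply: hr => //; exact: lt_le_trans etar.
(* The second bound decides: on the sphere [eqdist b x = eta], [key] gives
   [K / c * lyapx b kap x >= eta], and [lyapx] is conserved. *)
exists [set x | F0 x /\ eqdist b x < eta /\ K / c * lyapx b kap x < eta]; split.
- by move=> x [Fx [dx _]]; exact: hU'.
- have n1 : \forall x \near mu, eqdist b x < eta.
    have H : eqdist b mu < eta by rewrite eqdist_equilibrium.
    exact: (cvgr_lt _ (@eqdist_continuous R b mu) _ H).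
  have n2 : \forall x \near mu, lyapx b kap x < c / K * eta.
    have H : lyapx b kap mu < c / K * eta.
      by rewrite (lyapx_equilibrium E) // mulr_gt0 // divr_gt0.
    have L : lyapx b kap x @[x --> mu] --> lyapx b kap mu.
      exact: lyapx_continuous E kap mu b0 hx0.
    exact: (cvgr_lt _ L _ H).
  rewrite /within /=; near=> x => Fx; split=> //; split; first by near: x.
  rewrite mulrC -ltr_pdivlMr ?divr_gt0 // invf_div mulrC; near: x.
  exact: n2.
move=> T u sol T0 [F0u [d0u l0u]] t /andP[t0 tT].
have [hdom cu _] := sol.
have du s k : 0 < s < T -> (k < 9)%N ->
    is_derive s 1 (fun s => (u s).[: k]) ((2 * pi)^-1 * nth 0 (rate g (u s)) k).
  move=> hs k9; have := solution_coord k sol hs.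
  rewrite Xh_rate //; apply: hdom.
  by move: hs => /andP[s0 ->]; rewrite ltW.
have p0 : 0 <= (2 * pi)^-1 :> R by rewrite invr_ge0 mulr_ge0 // pi_ge0.
have cut s : 0 <= s < T -> {within `[0, s], continuous u}.
  by move=> /andP[s0 sT]; exact: within_sub cu.
have sub (s s' : R) : 0 < s < s' -> s' < T -> 0 < s < T.
  by move=> /andP[-> h1] h2; exact: lt_trans h2.
(* Closeness is required only strictly before [s], so rank one is available at the exit time itself,
   where the distance equals [eta]. *)
have adj s : 0 <= s < T -> (forall s', 0 < s' < s -> eqdist b (u s') < eta) -> adjcoord (u s) = 0.
  move=> hs hd; have /andP[s0 sT] := hs.
  apply: (@adjcoord_flow_eq0 R g u s _ 4 s0 p0 (cut s hs)).
  - by move=> s' k hs' k9; apply: du => //; exact: sub sT.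
  - move=> s' i j hs' i3 j3; apply: relMx_near hg b1 _ i3 j3 => k k9.
    apply: le_trans (_ : r0 <= _); last by rewrite /r0; lra.
    by apply: eqdist_coord k9 (ltW r0p) _; apply: le_trans etar0; apply: ltW; exact: hd.
  - exact: F0_adjcoord.
have lyap_const s : 0 <= s < T -> lyapx b kap (u s) = lyapx b kap (u 0).
  move=> hs; have /andP[s0 sT] := hs.
  have h00 : 0 <= (0 : R) < T by rewrite lexx T0.
  have Ei : impulse g (u s) = impulse g (u 0).
    apply: conserved_on hs cu _ _; first by move=> *; exact: impulse_continuous.
    by move=> s' hs'; apply: is_derive_impulse => k k9; apply: du => //; exact: sub sT.
  have Ee : energy g (u s) = energy g (u 0).
    apply: conserved_on hs cu _ _.
      move=> s' /andP[s'0 s's]; apply: energy_continuous; apply: hdom.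
      by rewrite s'0 (le_lt_trans s's).
    move=> s' hs'; have hs'T := sub _ _ hs' sT.
    apply: is_derive_energy; last by apply: hdom; move: hs'T => /andP[/ltW -> ->].
    by move=> k k9; exact: du.
  rewrite /lyapx /lyap !(dimpulseE E) !(denergyE E) ?Ei ?Ee //; exact: hdom.
have inside s : 0 <= s < T -> eqdist b (u s) < eta.
  move=> hs; have /andP[s0 sT] := hs; rewrite ltNge; apply/negP => hge.
  have ce : {within `[0, s], continuous (eqdist b \o u)}.
    by apply: within_comp (cut s hs) _ => s' _; exact: eqdist_continuous.
  have [s1 /andP[s10 s1s] [ds1 hs1]] := first_exit s0 ce d0u hge.
  have s1T : 0 <= s1 < T by rewrite s10 (le_lt_trans s1s).
  have rs1 : adjcoord (u s1) = 0.
    by apply: adj => // s' /andP[/ltW s'0 s's1]; apply: hs1; rewrite s'0.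
  have := key _ rs1; rewrite /= in ds1; rewrite ds1 => /(_ etar0).
  by rewrite lyap_const // leNgt l0u.
apply: hU'; last by apply: inside; rewrite t0.
have ht : 0 <= t < T by rewrite t0.
have rt : adjcoord (u t) = 0.
  apply: adj => // s' /andP[/ltW s'0 s't]; apply: inside; by rewrite s'0 (lt_trans s't).
split; last by rewrite /= adjcoord_Fmap.
apply: (vKring_near b1) => k k9.
apply: le_trans (_ : r0 <= _); last by rewrite /r0; lra.
by apply: eqdist_coord k9 (ltW r0p) _; apply: le_trans etar0; apply: ltW; exact: inside.
Unshelve. all: by end_near. Qed.

End Stable.

Theorem proposition6p2 (R : realType) (g : R) :
  -1 < g < 1 -> g != 0 ->
  let Gam := rhombus_circ g in
  ((-2 + Num.sqrt 3 < g < 0) \/ (0 < g < 1) ->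
     lyapunov_stable_in (hdomain (R := R)) (Xh Gam) (F0 (R := R)) (mu0 g)) /\
  (-1 < g < -2 + Num.sqrt 3 -> linearly_unstable (Xh Gam) (mu0 g)).
Proof.
move=> hg g0 Gam; have /andP[gN1 g1] := hg; split; last first.
  by move=> /andP[_ gt]; exact: rhombusA_unstable.
move=> h; apply: rhombusA_stable => //.
case: h => [/andP[gt _]|/andP[gt _]]; first by rewrite -threshold_gt.
by have := sqr_ge0 g; lra.
Qed.
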